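(* Let $A$ be a basic semiperfect Noetherian $k$-algebra with $A/\mathrm{rad}A$ finite dimensional over $k$, let $e$ be a primitive idempotent of $A$, let $\Gamma=(1-e)A(1-e)$ and $S_e=eA/e\,\mathrm{rad}A$. Assume that $\mathrm{Ext}^1_A(S_e,S_e)=0$. If both $\mathrm{gl.dim}\,A$ and $\mathrm{gl.dim}\,\Gamma$ are finite, then $S_e$ is self-orthogonal, that is, $\mathrm{Ext}^i_A(S_e,S_e)=0$ for all $i>0$.
   Context: $k$ is an algebraically closed field. Algebras are associative and unital; Noetherian means left and right Noetherian. $\mathrm{rad}A$ is the Jacobson radical of $A$. Semiperfect means that $A/\mathrm{rad}A$ is semisimple and idempotents lift modulo $\mathrm{rad}A$; basic means that $A/\mathrm{rad}A$ is a finite product of division algebras (here necessarily copies of $k$). Modules are right modules; $\mathrm{gl.dim}$ is the global dimension (left and right agree for Noetherian algebras). *)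

(* Defs.v *)
From HB Require Import structures.
From mathcomp Require Import all_boot all_order all_algebra.
From mathcomp Require Import boolp.

Set Implicit Arguments.
Unset Strict Implicit.
Unset Printing Implicit Defensive.

Import GRing.Theory.
Local Open Scope ring_scope.
Local Open Scope quotient_scope.

(* MathComp modules are left modules, so a right A-module is an lmodType over
   the converse ring A^c.  In particular A^c^o is A as a right module over
   itself: for x : A^c^o and a : A^c, the vector a *: x is the element x * a
   of A. *)
Notation rmodType A := (lmodType A^c).
Notation rreg_mod A := (A^c^o).

(* Submodules are MathComp's boolean submodClosed predicates; under the
   classical axioms of boolp these are all the submodules. *)

Section ModuleNotions.
Variable R : pzRingType.

Definition noetherian_module (M : lmodType R) : Prop :=
  forall N : nat -> submodClosed M,
    (forall n, {subset N n <= N n.+1}) ->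
    exists n, forall m, (n <= m)%N -> N m =i N n.

Definition semisimple_module (M : lmodType R) : Prop :=
  forall N : submodClosed M, exists N' : submodClosed M,
    (forall x, x \in N -> x \in N' -> x = 0) /\
    (forall x, exists y z, [/\ y \in N, z \in N' & x = y + z]).

Definition maximal_submodule (M : lmodType R) (N : submodClosed M) : Prop :=
  (exists x, x \notin N) /\
  forall N' : submodClosed M, {subset N <= N'} ->
    N' =i N \/ (forall x, x \in N').

Definition projective (P : lmodType R) : Prop :=
  forall (M N : lmodType R) (g : {linear M -> N}) (f : {linear P -> N}),
    (forall y, exists x, g x = y) ->
    exists h : {linear P -> M}, forall x, g (h x) = f x.

Record proj_resolution (M : lmodType R) := ProjResolution {
  res_obj :> nat -> lmodType R;
  res_diff : forall i, {linear res_obj i.+1 -> res_obj i};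
  res_aug : {linear res_obj 0%N -> M};
  res_projective : forall i, projective (res_obj i);
  res_aug_surj : forall y, exists x, res_aug x = y;
  res_aug_exact : forall x, res_aug x = 0 <-> exists y, res_diff 0 y = x;
  res_exact : forall i x,
    res_diff i x = 0 <-> exists y, res_diff i.+1 y = x
}.

Definition pdim_le (M : lmodType R) (n : nat) : Prop :=
  exists P : proj_resolution M,
    forall i, (n < i)%N -> forall x : P i, x = 0.

Definition cocycle (M N : lmodType R) (P : proj_resolution M) (i : nat)
    (f : {linear P i -> N}) : Prop :=
  forall x, f (res_diff P i x) = 0.

Definition coboundary (M N : lmodType R) (P : proj_resolution M) (i : nat) :
    {linear P i -> N} -> Prop :=
  match i with
  | 0 => fun f => forall x, f x = 0
  | j.+1 => fun f =>
      exists g : {linear P j -> N}, forall x, f x = g (res_diff P j x)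
  end.

(* Ext^i_R(M, N) = 0, where Ext^i_R(M, N) is the i-th cohomology group of
   Hom_R(P, N) for a projective resolution P of M.  This group does not depend
   on P up to isomorphism, and M has a projective resolution (a free one), so
   quantifying over all P is the same as fixing one. *)
Definition Ext_eq0 (i : nat) (M N : lmodType R) : Prop :=
  forall (P : proj_resolution M) (f : {linear P i -> N}),
    cocycle f -> coboundary f.

End ModuleNotions.

Section QuotientModule.
Variables (R : pzRingType) (M : lmodType R) (N : submodClosed M).

(* submodClosed does not extend zmodClosed, which Quotient.quot expects. *)
Definition submod_pred : {pred M} := N.
HB.instance Definition _ := GRing.isZmodClosed.Build M submod_pred
  (GRing.submod_closedB (submodClosedP N)).

Definition quotmod : Type := Quotient.quot submod_pred.
HB.instance Definition _ := GRing.Zmodule.on quotmod.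

Definition quotmod_pi (x : M) : quotmod := \pi_(Quotient.quot submod_pred) x.

Definition quotmod_scale (a : R) (u : quotmod) : quotmod :=
  quotmod_pi (a *: repr (u : Quotient.quot submod_pred)).

Lemma quotmod_piP x y : reflect (quotmod_pi x = quotmod_pi y) (x - y \in N).
Proof. by rewrite (Quotient.idealrBE submod_pred); apply: eqP. Qed.

Lemma quotmod_piD x y : quotmod_pi (x + y) = quotmod_pi x + quotmod_pi y.
Proof. exact: (raddfD (\pi_(Quotient.quot submod_pred))). Qed.

Lemma quotmod_piK (u : quotmod) : exists x, u = quotmod_pi x.
Proof. by exists (repr (u : Quotient.quot submod_pred)); rewrite /quotmod_pi reprK. Qed.

Lemma quotmod_piZ a x : quotmod_scale a (quotmod_pi x) = quotmod_pi (a *: x).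
Proof.
apply/quotmod_piP; rewrite -scalerBr rpredZ //; apply/quotmod_piP.
by rewrite /quotmod_pi reprK.
Qed.

Fact quotmod_scaleA a b u :
  quotmod_scale a (quotmod_scale b u) = quotmod_scale (a * b) u.
Proof. by have [x ->] := quotmod_piK u; rewrite !quotmod_piZ scalerA. Qed.

Fact quotmod_scale1 : left_id 1 quotmod_scale.
Proof. by move=> u; have [x ->] := quotmod_piK u; rewrite quotmod_piZ scale1r. Qed.

Fact quotmod_scaleDr : right_distributive quotmod_scale +%R.
Proof.
move=> a u v; have [x ->] := quotmod_piK u; have [y ->] := quotmod_piK v.
by rewrite -quotmod_piD !quotmod_piZ scalerDr quotmod_piD.
Qed.

Fact quotmod_scaleDl u : {morph quotmod_scale^~ u : a b / a + b}.
Proof.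
move=> a b; have [x ->] := quotmod_piK u.
by rewrite !quotmod_piZ scalerDl quotmod_piD.
Qed.

HB.instance Definition _ := GRing.Zmodule_isLmodule.Build R quotmod
  quotmod_scaleA quotmod_scale1 quotmod_scaleDr quotmod_scaleDl.

End QuotientModule.

Section RingNotions.
Variable A : pzRingType.

Definition noetherian_ring : Prop :=
  noetherian_module (A^o : lmodType A) /\
  noetherian_module (rreg_mod A : rmodType A).

Definition semisimple_ring : Prop :=
  semisimple_module (rreg_mod A : rmodType A).

Definition gldim_le (n : nat) : Prop :=
  forall M : rmodType A, pdim_le M n.

Definition finite_gldim : Prop := exists n, gldim_le n.

Definition idempotent_elt (e : A) : Prop := e * e = e.

Definition primitive_idempotent (e : A) : Prop :=
  [/\ idempotent_elt e, e != 0 &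
      forall e1 e2 : A, idempotent_elt e1 -> idempotent_elt e2 ->
        e1 * e2 = 0 -> e2 * e1 = 0 -> e = e1 + e2 -> e1 = 0 \/ e2 = 0].

Lemma primitive_idem e : primitive_idempotent e -> idempotent_elt e.
Proof. by case. Qed.

Lemma idempotent_compl e : idempotent_elt e -> idempotent_elt (1 - e).
Proof.
by move=> ee; rewrite /idempotent_elt mulrBl mul1r mulrBr mulr1 ee subrr subr0.
Qed.

Definition jacobson : {pred rreg_mod A} := fun x =>
  `[< forall I : submodClosed (rreg_mod A), maximal_submodule I -> x \in I >].

Fact jacobson_closed : submod_closed jacobson.
Proof.
split=> [|a x y /asboolP xJ /asboolP yJ]; apply/asboolP => I maxI.
  exact: rpred0.
by rewrite rpredD ?rpredZ ?xJ ?yJ.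
Qed.
HB.instance Definition _ :=
  GRing.isSubmodClosed.Build A^c (rreg_mod A) jacobson jacobson_closed.

Definition lmul_preim (a : A) (I : submodClosed (rreg_mod A)) :
  {pred rreg_mod A} := fun y => (a * (y : A) : A) \in I.

Lemma lmul_preimE a (I : submodClosed (rreg_mod A)) (y : A) :
  ((y : rreg_mod A) \in lmul_preim a I) = ((a * y : A) \in I).
Proof. by []. Qed.

Fact lmul_preim_closed a I : submod_closed (lmul_preim a I).
Proof.
split=> [|b x y]; rewrite !lmul_preimE; first by rewrite mulr0; exact: (rpred0 I).
move=> xI yI; rewrite mulrDr mulrA.
by apply: rpredD yI; apply: (rpredZ (b : A^c) xI).
Qed.
HB.instance Definition _ a I := GRing.isSubmodClosed.Build A^c (rreg_mod A)
  (lmul_preim a I) (lmul_preim_closed a I).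

Definition add_principal (z : A) (I : submodClosed (rreg_mod A)) :
  {pred rreg_mod A} := fun y => `[< exists t : A, y - (z * t : A) \in I >].

Fact add_principal_closed z I : submod_closed (add_principal z I).
Proof.
split=> [|b x y].
  by apply/asboolP; exists 0; rewrite mulr0 subr0 rpred0.
move=> /asboolP[t xI] /asboolP[s yI]; apply/asboolP; exists (t * (b : A) + s).
rewrite mulrDr mulrA opprD addrACA.
by apply: rpredD yI; have := rpredZ (b : A^c) xI; rewrite scalerBr.
Qed.
HB.instance Definition _ z I := GRing.isSubmodClosed.Build A^c (rreg_mod A)
  (add_principal z I) (add_principal_closed z I).

Lemma jacobson_mull (a x : A) : x \in jacobson -> a * x \in jacobson.
Proof.
move=> /asboolP xJ; apply/asboolP => I maxI; have [_ maxIP] := maxI.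
case: (boolP ((a : rreg_mod A) \in I)) => [aI|aNI].
  exact: (rpredZ (x : A^c) aI).
suff /xJ : maximal_submodule (lmul_preim a I : submodClosed (rreg_mod A)) by [].
split=> [|K JK]; first by exists 1; rewrite lmul_preimE mulr1.
case: (pselect (exists2 z, z \in K & z \notin lmul_preim a I)); last first.
  move=> KJ; left=> z; apply/idP/idP => [zK|/JK//].
  by apply: contrapT => /negP zJ; apply: KJ; exists z.
move=> [z zK zNJ]; right=> y.
have IL : {subset I <= add_principal (a * z) I}.
  by move=> u uI; apply/asboolP; exists 0; rewrite mulr0 subr0.
case: (maxIP _ IL) => [LI|/(_ (a * (y : A) : A))/asboolP[t ayI]].
  case/negP: zNJ; rewrite lmul_preimE -LI; apply/asboolP.
  by exists 1; rewrite mulr1 subrr rpred0.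
have : y - ((z : A) * t : A) \in K 
  by apply: JK; rewrite lmul_preimE mulrBr mulrA.
by move=> /rpredD/(_ (rpredZ (t : A^c) zK)); rewrite subrK.
Qed.

Definition principal (e : A) : {pred rreg_mod A} := fun y =>
  `[< exists a : A, y = e * a :> A >].

Fact principal_closed e : submod_closed (principal e).
Proof.
split=> [|b x y]; first by apply/asboolP; exists 0; rewrite mulr0.
move=> /asboolP[t ->] /asboolP[s ->]; apply/asboolP.
by exists (t * (b : A) + s); rewrite mulrDr mulrA.
Qed.
HB.instance Definition _ e := GRing.isSubmodClosed.Build A^c (rreg_mod A)
  (principal e) (principal_closed e).

Definition principal_mod (e : A) : Type := {x : rreg_mod A | x \in principal e}.
HB.instance Definition _ e := SubType.on (principal_mod e).
HB.instance Definition _ e := Choice.on (principal_mod e).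
HB.instance Definition _ e := [SubChoice_isSubLmodule of principal_mod e by <:].

Definition principal_rad (e : A) : {pred principal_mod e} := fun y =>
  `[< exists2 r : A, r \in jacobson & val y = e * r :> A >].
Arguments principal_rad : clear implicits.

Fact principal_rad_closed e : submod_closed (principal_rad e).
Proof.
split=> [|b x y].
  by apply/asboolP; exists 0; rewrite ?rpred0 // mulr0.
move=> /asboolP[t tJ xE] /asboolP[s sJ yE]; apply/asboolP.
exists (t * (b : A) + s); first by apply: rpredD sJ; apply: (rpredZ (b : A^c) tJ).
by rewrite mulrDr mulrA -xE -yE.
Qed.
HB.instance Definition _ e := GRing.isSubmodClosed.Build A^c (principal_mod e)
  (principal_rad e) (principal_rad_closed e).

Definition simple_top (e : A) : rmodType A := quotmod (principal_rad e).

End RingNotions.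
Arguments principal_rad [A] e _.

(* f A f is the zero ring when f = 0, so it is only a pzRingType. *)
Section Corner.
Variables (A : pzRingType) (f : A) (ff : idempotent_elt f).

Definition corner_pred : {pred A} := fun x => `[< exists a, x = f * a * f >].

Fact corner_zmod_closed : zmod_closed corner_pred.
Proof.
split=> [|x y]; first by apply/asboolP; exists 0; rewrite mulr0 mul0r.
move=> /asboolP[a ->] /asboolP[b ->]; apply/asboolP; exists (a - b).
by rewrite mulrBr mulrBl.
Qed.
HB.instance Definition _ :=
  GRing.isZmodClosed.Build A corner_pred corner_zmod_closed.

Definition corner of idempotent_elt f : Type := {x : A | x \in corner_pred}.
HB.instance Definition _ := SubType.on (corner ff).
HB.instance Definition _ := Choice.on (corner ff).
HB.instance Definition _ := [SubChoice_isSubZmodule of corner ff by <:].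

Fact corner_one_subproof : f \in corner_pred.
Proof. by apply/asboolP; exists 1; rewrite mulr1 ff. Qed.

Fact corner_mul_subproof (x y : corner ff) : val x * val y \in corner_pred.
Proof.
have /asboolP[a ->] := valP x; have /asboolP[b ->] := valP y.
by apply/asboolP; exists (a * f * f * b); rewrite !mulrA.
Qed.

Definition corner_one : corner ff := Sub f corner_one_subproof.
Definition corner_mul (x y : corner ff) : corner ff :=
  Sub (val x * val y) (corner_mul_subproof x y).

Fact corner_mulA : associative corner_mul.
Proof. by move=> x y z; apply: val_inj; rewrite /= mulrA. Qed.
Fact corner_mul1 : left_id corner_one corner_mul.
Proof.
move=> x; apply: val_inj; have /asboolP[a /= ->] := valP x.
by rewrite !mulrA ff.
Qed.
Fact corner_mulr1 : right_id corner_one corner_mul.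
Proof.
move=> x; apply: val_inj; have /asboolP[a /= ->] := valP x.
by rewrite -!mulrA ff.
Qed.
Fact corner_mulDl : left_distributive corner_mul +%R.
Proof. by move=> x y z; apply: val_inj; rewrite /= mulrDl. Qed.
Fact corner_mulDr : right_distributive corner_mul +%R.
Proof. by move=> x y z; apply: val_inj; rewrite /= mulrDr. Qed.

HB.instance Definition _ := GRing.Zmodule_isPzRing.Build (corner ff)
  corner_mulA corner_mul1 corner_mulr1 corner_mulDl corner_mulDr.

End Corner.

(* A / rad A.  MathComp's algType requires 1 != 0, so the ring and k-module
   structures are given separately. *)
Section ResidueAlgebra.
Variables (k : comNzRingType) (A : algType k).

Definition residue : Type := Quotient.quot (@jacobson A).
HB.instance Definition _ := GRing.Zmodule.on residue.

Definition residue_pi (x : A) : residue := \pi_(Quotient.quot (@jacobson A)) x.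

Let rep (u : residue) : A := repr (u : Quotient.quot (@jacobson A)).

Definition residue_mul (u v : residue) : residue := residue_pi (rep u * rep v).
Definition residue_scale (c : k) (u : residue) : residue :=
  residue_pi (c *: rep u).

Lemma residue_piP (x y : A) :
  reflect (residue_pi x = residue_pi y) ((x - y : A) \in @jacobson A).
Proof. by rewrite (Quotient.idealrBE (@jacobson A)); apply: eqP. Qed.

Lemma residue_piD x y : residue_pi (x + y) = residue_pi x + residue_pi y.
Proof. exact: (raddfD (\pi_(Quotient.quot (@jacobson A)))). Qed.

Lemma residue_piK (u : residue) : exists x, u = residue_pi x.
Proof. by exists (rep u); rewrite /residue_pi reprK. Qed.

Let rep_pi x : (rep (residue_pi x) - x : A) \in @jacobson A.
Proof. by apply/residue_piP; rewrite /residue_pi reprK. Qed.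

Lemma jacobson_mulr (a x : A) : x \in @jacobson A -> x * a \in @jacobson A.
Proof. exact: (@rpredZ _ _ (@jacobson A) (a : A^c)). Qed.

Lemma residue_piM x y :
  residue_mul (residue_pi x) (residue_pi y) = residue_pi (x * y).
Proof.
apply/residue_piP; set x' := rep _; set y' := rep _.
have -> : x' * y' - x * y = (x' - x) * y' + x * (y' - y).
  by rewrite mulrBl mulrBr addrA subrK.
by apply: (rpredD (jacobson_mulr _ _) (jacobson_mull _ _)); apply: rep_pi.
Qed.

Lemma residue_piZ c x : residue_scale c (residue_pi x) = residue_pi (c *: x).
Proof.
apply/residue_piP; rewrite -scalerBr -[X in c *: X]mulr1 scalerAr.
exact: jacobson_mulr.
Qed.

Fact residue_mulA : associative residue_mul.
Proof.
move=> u v w; have [x ->] := residue_piK u; have [y ->] := residue_piK v.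
by have [z ->] := residue_piK w; rewrite !residue_piM mulrA.
Qed.
Fact residue_mul1 : left_id (residue_pi 1) residue_mul.
Proof. by move=> u; have [x ->] := residue_piK u; rewrite residue_piM mul1r. Qed.
Fact residue_mulr1 : right_id (residue_pi 1) residue_mul.
Proof. by move=> u; have [x ->] := residue_piK u; rewrite residue_piM mulr1. Qed.
Fact residue_mulDl : left_distributive residue_mul +%R.
Proof.
move=> u v w; have [x ->] := residue_piK u; have [y ->] := residue_piK v.
have [z ->] := residue_piK w.
by rewrite -residue_piD !residue_piM mulrDl residue_piD.
Qed.
Fact residue_mulDr : right_distributive residue_mul +%R.
Proof.
move=> u v w; have [x ->] := residue_piK u; have [y ->] := residue_piK v.
have [z ->] := residue_piK w.
by rewrite -residue_piD !residue_piM mulrDr residue_piD.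
Qed.

HB.instance Definition _ := GRing.Zmodule_isPzRing.Build residue
  residue_mulA residue_mul1 residue_mulr1 residue_mulDl residue_mulDr.

Fact residue_scaleA a b u :
  residue_scale a (residue_scale b u) = residue_scale (a * b) u.
Proof. by have [x ->] := residue_piK u; rewrite !residue_piZ scalerA. Qed.
Fact residue_scale1 : left_id 1 residue_scale.
Proof. by move=> u; have [x ->] := residue_piK u; rewrite residue_piZ scale1r. Qed.
Fact residue_scaleDr : right_distributive residue_scale +%R.
Proof.
move=> a u v; have [x ->] := residue_piK u; have [y ->] := residue_piK v.
by rewrite -residue_piD !residue_piZ scalerDr residue_piD.
Qed.
Fact residue_scaleDl u : {morph residue_scale^~ u : a b / a + b}.
Proof.
move=> a b; have [x ->] := residue_piK u.
by rewrite !residue_piZ scalerDl residue_piD.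
Qed.

HB.instance Definition _ := GRing.Zmodule_isLmodule.Build k residue
  residue_scaleA residue_scale1 residue_scaleDr residue_scaleDl.

End ResidueAlgebra.

Section AlgebraNotions.
Variables (k : fieldType) (A : algType k).

Definition finite_dimensional (V : lmodType k) : Prop :=
  exists (n : nat) (f : {linear V -> 'rV[k]_n}), bijective f.

Definition division_algebra (D : algType k) : Prop :=
  forall x : D, x != 0 -> exists y : D, x * y = 1 /\ y * x = 1.

Definition semiperfect : Prop :=
  semisimple_ring (residue A) /\
  (forall u : residue A, idempotent_elt u ->
     exists e : A, idempotent_elt e /\ residue_pi e = u).

(* The algebra isomorphism from A / rad A to D_1 x ... x D_n is given by its
   components. *)
Definition basic : Prop :=
  exists (n : nat) (D : 'I_n -> algType k)
         (p : forall i, {linear residue A -> D i}),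
    [/\ forall i, division_algebra (D i),
        forall i, monoid_morphism (p i) &
        forall y : (forall i, D i), exists! x, forall i, p i x = y i].

End AlgebraNotions.

(* Main.v *)
Require Import Defs.
From HB Require Import structures.
From mathcomp Require Import all_boot all_order all_algebra.
From mathcomp Require Import boolp.

(** Write f = 1 - e, S = S_e and Gamma = fAf. Since A is basic, Sf = 0; since
    Ext^1(S, S) = 0, the module e rad A has no nonzero map to S, and as A is
    Noetherian this gives e rad A = eAfA ([killed_rad]). Hence S is the only
    simple module killed by f, it embeds in every nonzero module killed by f, and
    Noetherian modules killed by f are iterated extensions of S.

    Suppose that Ext^i(S, S) is nonzero for some i > 0. As gl.dim A is finite
    there is a largest such degree m > 0. For a Noetherian module H with Hf = 0,
    Ext^j(H, S) = 0 for all j > m; and if H is nonzero then Ext^m(H, S) is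
    nonzero, because it maps onto Ext^m(S, S).

    Now cover a Noetherian module M by a module C = Q (x) fA, with Q projective
    over Gamma, such that C -> M is onto on the f-parts. Here C is projective and
    Hom(C, S) = 0, so Ext^j(C, S) = 0 in all degrees. The cokernel of C -> M is
    killed by f, and the f-part of the kernel is a syzygy of Mf over Gamma.
    Iterating this, finitely often because gl.dim Gamma is finite, the long exact
    sequences show: if Ext^j(M, S) = 0 for all j >= m, then Ext^j(M, S) = 0 for
    all j ([collapses_pd]). For M = eA the hypothesis holds, because eA is
    projective and m > 0; but Hom(eA, S) is nonzero. This contradiction proves
    the theorem.

    Only the vanishing of Ext is used, never the groups. It is expressed by
    dimension shifting ([Ext_vanish]), and the long exact sequence enters through
    [Ext_vanish_mid], [Ext_vanish_sub] and [Ext_vanish_quot]. *)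

Set Implicit Arguments.
Unset Strict Implicit.
Unset Printing Implicit Defensive.
Import GRing.Theory.
Local Open Scope ring_scope.


(** * Linear maps and short exact sequences *)

Section Linear.
Variable R : pzRingType.
Implicit Types K X M N P Q S W B : lmodType R.

(** Here and below, linear maps and modules come from existence statements that
    specify them pointwise. *)
Lemma linear_of M N (f : M -> N) : linear f -> {g : {linear M -> N} | g =1 f}.
Proof.
move=> fL.
pose g : {linear M -> N} := HB.pack f (GRing.isLinear.Build R M N *:%R f fL).
by exists g.
Qed.

Lemma submodule_of M (P : M -> Prop) :
  P 0 -> (forall a x y, P x -> P y -> P (a *: x + y)) ->
  {N : submodClosed M | forall x, x \in N <-> P x}.
Proof.
move=> P0 PL; pose p : {pred M} := fun x => `[< P x >].
have pc : submod_closed p.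
  split=> [|a x y /asboolP Px /asboolP Py]; apply/asboolP => //; exact: PL.
pose N : submodClosed M := HB.pack p (GRing.isSubmodClosed.Build R M p pc).
exists N.
by move=> x; split=> /asboolP.
Qed.

(** A submodule, given as a predicate, seen as a module of its own. *)
Definition submodule M (N : submodClosed M) : Type := {x : M | x \in N}.
HB.instance Definition _ M (N : submodClosed M) := SubType.on (submodule N).
HB.instance Definition _ M (N : submodClosed M) := Choice.on (submodule N).
HB.instance Definition _ M (N : submodClosed M) :=
  [SubChoice_isSubLmodule of submodule N by <:].

Lemma submodule_incl M (N : submodClosed M) :
  {i : {linear submodule N -> M} | i =1 val}.
Proof. by apply: linear_of => a x y; exact: linearP. Qed.

(** The submodule of the x with P x, as a module K with its inclusion i. *)
Lemma submod_exists M (P : M -> Prop) :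
  P 0 -> (forall a x y, P x -> P y -> P (a *: x + y)) ->
  exists K (i : {linear K -> M}), injective i /\ forall x, P x <-> exists k, i k = x.
Proof.
move=> P0 PL; have [N NP] := submodule_of P0 PL.
have [i iE] := submodule_incl N.
exists (submodule N), i; split=> [x y|x]; first by rewrite !iE => /val_inj.
rewrite -NP; split=> [xN|[k <-]]; last by rewrite iE (valP k).
by exists (Sub x xN); rewrite iE SubK.
Qed.

Lemma quotmod_exists M (N : submodClosed M) :
  {p : {linear M -> quotmod N} | p =1 @quotmod_pi R M N}.
Proof.
apply: linear_of => a x y.
by rewrite quotmod_piD -(quotmod_piZ N a x).
Qed.

Lemma lin_inj M N (u : {linear M -> N}) :
  (forall x, u x = 0 -> x = 0) -> injective u.
Proof.
by move=> u0 x y uxy; apply: subr0_eq; apply: u0; rewrite linearB uxy subrr.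
Qed.

Lemma inj0 M N (u : {linear M -> N}) x : injective u -> u x = 0 -> x = 0.
Proof. by move=> ui; rewrite -(raddf0 u) => /ui. Qed.

(** Factorization of a linear map through an injective one. *)
Lemma lin_lift K M X (i : {linear K -> M}) (u : {linear X -> M}) :
  injective i -> (forall x, exists k, i k = u x) ->
  exists v : {linear X -> K}, forall x, i (v x) = u x.
Proof.
move=> ii /choice[v vE]; have vL : linear v.
  by move=> a x y; apply: ii; rewrite linearP !vE linearP.
by have [w wE] := linear_of vL; exists w => x; rewrite wE.
Qed.

(** Factorization of a linear map through a surjective one. *)
Lemma lin_desc X Q N (p : {linear X -> Q}) (u : {linear X -> N}) :
  (forall y, exists x, p x = y) -> (forall x, p x = 0 -> u x = 0) ->
  exists v : {linear Q -> N}, forall x, v (p x) = u x.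
Proof.
move=> /choice[s sE] ku; have us x : u (s (p x)) = u x.
  by apply: subr0_eq; rewrite -linearB; apply: ku; rewrite linearB sE subrr.
have vL : linear (u \o s).
  move=> a x y /=; rewrite -linearP -us -[RHS]us.
  by rewrite sE linearP !sE.
by have [w wE] := linear_of vL; exists w => x; rewrite wE /= us.
Qed.

(** [ses i p]: the sequence 0 -> K -> X -> M -> 0 is exact. *)
Definition ses K X M (i : {linear K -> X}) (p : {linear X -> M}) : Prop :=
  [/\ injective i, forall y, exists x, p x = y &
      forall x, p x = 0 <-> exists k, i k = x].

Lemma ses0 K X M (i : {linear K -> X}) (p : {linear X -> M}) k :
  ses i p -> p (i k) = 0.
Proof. by case=> _ _ e; apply/e; exists k. Qed.

Lemma ker_ses X M (p : {linear X -> M}) : (forall y, exists x, p x = y) ->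
  exists K (i : {linear K -> X}), ses i p.
Proof.
move=> ps; have [||K [i [ii iE]]] := @submod_exists X (fun x => p x = 0).
- exact: raddf0.
- by move=> a x y px py; rewrite linearP px py scaler0 addr0.
by exists K, i; split.
Qed.

Lemma image_submod M N (u : {linear M -> N}) (U : submodClosed M) :
  {V : submodClosed N | forall y, y \in V <-> exists2 x, x \in U & u x = y}.
Proof.
apply: submodule_of => [|a _ _ [x xU <-] [y yU <-]].
  by exists 0; rewrite ?raddf0 ?rpred0.
by exists (a *: x + y); [rewrite rpredD ?rpredZ|rewrite linearP].
Qed.

Lemma preim_submod M N (u : {linear M -> N}) (V : submodClosed N) :
  {U : submodClosed M | forall x, x \in U <-> u x \in V}.
Proof.
apply: submodule_of => [|a x y xV yV]; first by rewrite raddf0 rpred0.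
by rewrite linearP rpredD ?rpredZ.
Qed.

Lemma range_submod M N (u : {linear M -> N}) :
  {V : submodClosed N | forall y, y \in V <-> exists x, u x = y}.
Proof.
apply: submodule_of => [|a _ _ [x <-] [y <-]]; first by exists 0; rewrite raddf0.
by exists (a *: x + y); rewrite linearP.
Qed.

Lemma coker_ses K X (i : {linear K -> X}) : injective i ->
  exists M (p : {linear X -> M}), ses i p.
Proof.
move=> ii; have [N NE] := range_submod i.
have [p pE] := quotmod_exists N; exists (quotmod N), p; split=> //.
  by move=> y; have [x ->] := quotmod_piK y; exists x.
move=> x; rewrite -NE; have p0 : quotmod_pi N 0 = 0 by rewrite -pE raddf0.
by rewrite pE -p0; split=> [/quotmod_piP|xN]; [|apply/quotmod_piP]; rewrite subr0.
Qed.

Lemma image_exists X M (u : {linear X -> M}) :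
  exists B (i : {linear B -> M}) (p : {linear X -> B}),
    [/\ injective i, forall y, exists x, p x = y & forall x, i (p x) = u x].
Proof.
have [||B [i [ii iE]]] := @submod_exists M (fun y => exists x, u x = y).
- by exists 0; rewrite raddf0.
- by move=> a _ _ [k <-] [l <-]; exists (a *: k + l); rewrite linearP.
have [|p pE] := @lin_lift _ _ _ i u ii.
  by move=> x; apply/iE; exists x.
exists B, i, p; split=> // y.
have /iE[x ux] : exists k, i k = i y by exists y.
by exists x; apply: ii; rewrite pE.
Qed.

Lemma lin_comp M N X (v : {linear N -> X}) (u : {linear M -> N}) :
  exists w : {linear M -> X}, forall x, w x = v (u x).
Proof. by exists (v \o u). Qed.

Lemma lin_id M : exists w : {linear M -> M}, forall x, w x = x.
Proof. by exists idfun. Qed.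

Lemma lin0 M N : exists w : {linear M -> N}, forall x, w x = 0.
Proof. by exists \0. Qed.

Lemma lin_sub M N (u v : {linear M -> N}) :
  exists w : {linear M -> N}, forall x, w x = u x - v x.
Proof.
exists (u \- v) => x //.
Qed.

Lemma lin_fst M N : exists w : {linear (M * N)%type -> M}, forall x, w x = x.1.
Proof. by exists fst. Qed.
Lemma lin_snd M N : exists w : {linear (M * N)%type -> N}, forall x, w x = x.2.
Proof. by exists snd. Qed.

Lemma lin_copair M N X (u : {linear M -> X}) (v : {linear N -> X}) :
  exists w : {linear (M * N)%type -> X}, forall x, w x = u x.1 + v x.2.
Proof.
have L : linear (fun x : M * N => u x.1 + v x.2).
  by move=> a x y /=; rewrite !linearP scalerDr addrACA.
by have [w wE] := linear_of L; exists w.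
Qed.

Lemma lin_pair M N X (u : {linear X -> M}) (v : {linear X -> N}) :
  exists w : {linear X -> (M * N)%type}, forall x, w x = (u x, v x).
Proof.
have L : linear (fun x : X => (u x, v x)).
  by move=> a x y /=; rewrite !linearP.
by have [w wE] := linear_of L; exists w.
Qed.

(** The last conjunct says that the fibre product is a submodule of X x M; no
    surjectivity is assumed. *)
Lemma pullback_exists X M Q (p : {linear X -> Q}) (q : {linear M -> Q}) :
  exists W (a : {linear W -> X}) (b : {linear W -> M}),
   [/\ forall w, p (a w) = q (b w),
     forall x y, p x = q y -> exists w, a w = x /\ b w = y &
     forall w, a w = 0 -> b w = 0 -> w = 0].
Proof.
have [||W [i [ii iE]]] := @submod_exists (X * M)%type (fun z => p z.1 = q z.2).
- by rewrite !raddf0.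
- by move=> a x y px py; rewrite !linearP px py.
have [f1 f1E] := lin_fst X M; have [f2 f2E] := lin_snd X M.
have [a aE] := lin_comp f1 i; have [b bE] := lin_comp f2 i.
exists W, a, b; split=> [w|x y pq|w].
- by rewrite aE bE f1E f2E; apply/iE; exists w.
- have /iE[w wE] : p (x, y).1 = q (x, y).2 by [].
  by exists w; rewrite aE bE f1E f2E wE.
- rewrite aE bE f1E f2E => w1 w2; apply: (inj0 ii).
  by rewrite [i w]surjective_pairing w1 w2.
Qed.

End Linear.

(** * Vanishing of Ext by dimension shifting *)

Section Ext_vanish.
Variables (R : pzRingType) (S : lmodType R).
Implicit Types K X M N P Q W B L KM KQ : lmodType R.

(** [Ext_vanish S j M] says that Ext^j(M, S) = 0, by recursion on j. In degree 0
    this is Hom(M, S) = 0; in degree 1, every map K -> S extends along every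
    extension X of M by K; in degree j + 2, every first syzygy of M has vanishing
    Ext^(j+1). Quantifying over all extensions and all syzygies makes the
    vanishing hypotheses directly applicable; that one syzygy is enough is a
    consequence of [Ext_vanish_quot] below. *)
Fixpoint Ext_vanish (j : nat) (M : lmodType R) {struct j} : Prop :=
  match j with
  | 0 => forall (g : {linear M -> S}) x, g x = 0
  | j'.+1 =>
    match j' with
    | 0 => forall (K X : lmodType R) (i : {linear K -> X}) (p : {linear X -> M}),
        ses i p -> forall g : {linear K -> S}, exists h : {linear X -> S},
        forall k, h (i k) = g k
    | _.+1 => forall (K P : lmodType R) (i : {linear K -> P}) (p : {linear P -> M}),
        projective P -> ses i p -> Ext_vanish j' K
    end
  end.

Lemma proj_retract P K (i : {linear K -> P}) (r : {linear P -> K}) :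
  projective P -> (forall k, r (i k) = k) -> projective K.
Proof.
move=> Pp ri M N g f gs; have [fr frE] := lin_comp f r.
have [h hE] := Pp M N g fr gs; have [hi hiE] := lin_comp h i.
by exists hi => x; rewrite hiE hE frE ri.
Qed.

Lemma ses_split K X P (i : {linear K -> X}) (p : {linear X -> P}) :
  projective P -> ses i p -> exists r : {linear X -> K}, forall k, r (i k) = k.
Proof.
move=> Pp s; have [ii ps ie] := s; have [one oneE] := lin_id P.
have [t tE] := Pp _ _ p one ps; have [tp tpE] := lin_comp t p.
have [oX oXE] := lin_id X; have [d dE] := lin_sub oX tp.
have [|r rE] := lin_lift (u := d) ii.
  by move=> x; apply/ie; rewrite dE linearB oXE tpE tE oneE subrr.
exists r => k; apply: ii.
by rewrite rE dE oXE tpE (ses0 _ s) raddf0 subr0.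
Qed.

Lemma proj_ker K (P' : lmodType R) P (i : {linear K -> P'}) (p : {linear P' -> P}) :
  projective P' -> projective P -> ses i p -> projective K.
Proof.
by move=> Pp' Pp s; have [r rE] := ses_split Pp s; apply: proj_retract rE.
Qed.

Lemma Ext_vanish_proj j P : projective P -> Ext_vanish j.+1 P.
Proof.
elim: j P => [|j IH] P Pp K X i p.
  move=> s g; have [r rE] := ses_split Pp s.
  by have [h hE] := lin_comp g r; exists h => k; rewrite hE rE.
by move=> Xp s; apply: IH; apply: proj_ker s.
Qed.

(** Let 0 -> K -> M -> Q -> 0 be exact and u : P -> M surjective. The kernels KM
    of u and KQ of P -> M -> Q fit in an exact sequence 0 -> KM -> KQ -> K -> 0.
    This is what moves one step along the long exact sequence of Ext. *)
Lemma ses_rotate K M Q P KM KQ (i : {linear K -> M}) (p : {linear M -> Q})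
    (a : {linear KM -> P}) (u : {linear P -> M})
    (b : {linear KQ -> P}) (v : {linear P -> Q}) :
  ses i p -> ses a u -> (forall x, v x = p (u x)) -> ses b v ->
  exists (c : {linear KM -> KQ}) (d : {linear KQ -> K}),
    ses c d /\ forall x, b (c x) = a x.
Proof.
move=> s1 s2 uv s3; have [ii ps ie] := s1; have [ai us ae] := s2.
have [bi vs be] := s3.
have [|c cE] := lin_lift (u := a) bi.
  by move=> x; apply/be; rewrite uv (ses0 _ s2) raddf0.
have [ub ubE] := lin_comp u b.
have [|d dE] := lin_lift (u := ub) ii.
  by move=> x; apply/ie; rewrite ubE -uv (ses0 _ s3).
exists c, d; split=> //; split.
- apply: lin_inj => x cx0; apply: (inj0 ai); by rewrite -cE cx0 raddf0.
- move=> k; have [x xE] := us (i k).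
  have /be[y yE] : v x = 0 by rewrite uv xE (ses0 _ s1).
  by exists y; apply: ii; rewrite dE ubE yE.
move=> y; split=> [dy0|[x <-]]; last first.
  by apply: (inj0 ii); rewrite dE ubE cE (ses0 _ s2).
have /ae[x xE] : u (b y) = 0 by rewrite -ubE -dE dy0 raddf0.
by exists x; apply: bi; rewrite cE.
Qed.

(** The fibre product W of p : X -> Q and q : M -> Q is an extension of M by the
    kernel of p, and an extension of X by the kernel of q. *)
Lemma ses_pullback X M Q N L (p : {linear X -> Q}) (q : {linear M -> Q})
    (i : {linear N -> X}) (l : {linear L -> M}) :
  ses i p -> ses l q ->
  exists W (a : {linear W -> X}) (b : {linear W -> M})
    (c : {linear N -> W}) (d : {linear L -> W}),
    [/\ ses c b, ses d a, forall x, a (c x) = i x, forall x, b (d x) = l x &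
        forall w, p (a w) = q (b w)].
Proof.
move=> s1 s2; have [W [a [b [pq ex un]]]] := pullback_exists p q.
have [ii ps ie] := s1; have [li qs le] := s2.
have inj2 w w' : a w = a w' -> b w = b w' -> w = w'.
  move=> aw bw; apply: subr0_eq; apply: un; rewrite linearB ?aw ?bw subrr //.
have /choice[c0 c0E] : forall x, exists w, a w = i x /\ b w = 0.
  by move=> x; apply: ex; rewrite (ses0 _ s1) raddf0.
have /choice[d0 d0E] : forall x, exists w, a w = 0 /\ b w = l x.
  by move=> x; apply: ex; rewrite (ses0 _ s2) raddf0.
have cL : linear c0.
  move=> r x y; have [c1 c2] := c0E x; have [c3 c4] := c0E y.
  have [c5 c6] := c0E (r *: x + y); apply: inj2.
    by rewrite linearP c1 c3 c5 linearP.
  by rewrite linearP c2 c4 c6 scaler0 addr0.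
have dL : linear d0.
  move=> r x y; have [c1 c2] := d0E x; have [c3 c4] := d0E y.
  have [c5 c6] := d0E (r *: x + y); apply: inj2.
    by rewrite linearP c1 c3 c5 scaler0 addr0.
  by rewrite linearP c2 c4 c6 linearP.
have [c cE] := linear_of cL; have [d dE] := linear_of dL.
exists W, a, b, c, d; split=> //.
- split.
  + apply: lin_inj => x cx; apply: (inj0 ii).
    by have [<- _] := c0E x; rewrite -cE cx raddf0.
  + by move=> y; have [x xE] := ps (q y); have [w [_ wE]] := ex _ _ xE; exists w.
  move=> w; split=> [bw|[x <-]]; last by rewrite cE; case: (c0E x).
  have /ie[x xE] : p (a w) = 0 by rewrite pq bw raddf0.
  by have [c1 c2] := c0E x; exists x; rewrite cE; apply: inj2; rewrite ?c1 ?c2 ?xE ?bw.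
- split.
  + apply: lin_inj => x cx; apply: (inj0 li).
    by have [_ <-] := d0E x; rewrite -dE cx raddf0.
  + move=> y; have [x xE] := qs (p y).
    by have [w [wE _]] := ex _ _ (esym xE); exists w.
  move=> w; split=> [aw|[x <-]]; last by rewrite dE; case: (d0E x).
  have /le[x xE] : q (b w) = 0 by rewrite -pq aw raddf0.
  by have [c1 c2] := d0E x; exists x; rewrite dE; apply: inj2; rewrite ?c1 ?c2 ?xE ?aw.
- by move=> x; rewrite cE; case: (c0E x).
- by move=> x; rewrite dE; case: (d0E x).
Qed.

(** The part of the long exact sequence around the connecting map
    Hom(K, S) -> Ext^1(Q, S). *)
Lemma Ext1_vanish_quot K M Q (i : {linear K -> M}) (p : {linear M -> Q}) : ses i p ->
  (forall g : {linear K -> S}, exists h : {linear M -> S}, forall k, h (i k) = g k) ->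
  Ext_vanish 1 M -> Ext_vanish 1 Q.
Proof.
move=> s ext EM L X l q s' g.
have [W [a [b [c [d [cb da acE bdE pq]]]]]] := ses_pullback s' s.
have [h hE] := EM _ _ _ _ cb g.
have [hd hdE] := lin_comp h d; have [h0 h0E] := ext hd.
have [h0b h0bE] := lin_comp h0 b; have [h1 h1E] := lin_sub h h0b.
have [di as_ de] := da.
have [|v vE] := lin_desc (u := h1) as_.
  move=> w /de[x <-]; by rewrite h1E h0bE bdE h0E hdE subrr.
exists v => k; rewrite -acE vE h1E h0bE hE.
by rewrite (ses0 _ cb) raddf0 subr0.
Qed.

Lemma Ext1_vanish_ext K M Q (i : {linear K -> M}) (p : {linear M -> Q}) : ses i p ->
  Ext_vanish 1 K -> Ext_vanish 1 Q -> Ext_vanish 1 M.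
Proof.
move=> s EK EQ L X l q s' g.
have [pq pqE] := lin_comp p q; have [li qs le] := s'; have [ii ps ie] := s.
have pqs : forall y, exists x, pq x = y.
  by move=> y; have [z <-] := ps y; have [x <-] := qs z; exists x; rewrite pqE.
have [X' [j s3]] := ker_ses pqs.
have [c [d [s4 cE]]] := ses_rotate s s' pqE s3.
have [h hE] := EK _ _ _ _ s4 g; have [h' h'E] := EQ _ _ _ _ s3 h.
by exists h' => k; rewrite -cE h'E hE.
Qed.

(** Every module is a quotient of a projective one. Over a ring of finite global
    dimension the projective resolutions provide this. *)
Definition enough_projectives := forall M, exists P (p : {linear P -> M}),
  projective P /\ forall y, exists x, p x = y.

Hypothesis En : enough_projectives.

Lemma presentation M : exists K P (i : {linear K -> P}) (p : {linear P -> M}),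
  projective P /\ ses i p.
Proof.
have [P [p [Pp ps]]] := En M; have [K [i s]] := ker_ses ps.
by exists K, P, i, p.
Qed.

Lemma rotate_from K M Q P KM (i : {linear K -> M}) (p : {linear M -> Q})
    (a : {linear KM -> P}) (u : {linear P -> M}) :
  ses i p -> ses a u ->
  exists KQ (b : {linear KQ -> P}) (v : {linear P -> Q}) (c : {linear KM -> KQ}) 
     (d : {linear KQ -> K}), [/\ ses b v, ses c d & forall x, b (c x) = a x].
Proof.
move=> s s'; have [v vE] := lin_comp p u.
have [_ ps _] := s; have [_ us _] := s'.
have vs : forall y, exists x, v x = y.
  by move=> y; have [z <-] := ps y; have [x <-] := us z; exists x; rewrite vE.
have [KQ [b s3]] := ker_ses vs.
have [c [d [s4 cE]]] := ses_rotate s s' vE s3.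
by exists KQ, b, v, c, d.
Qed.

(** Vanishing consequences of the long exact sequence of Ext(-, S), one
    for each of the three positions. They are proved together by induction on j: rotating the
    sequence along a presentation of M lowers the degree by one and permutes the
    three statements. The third one has to hold for every presentation of Q, and
    Schanuel's fibre product compares an arbitrary one with the one given by M. *)
Lemma Ext_vanish_les j :
  [/\ forall K M Q (i : {linear K -> M}) (p : {linear M -> Q}), ses i p ->
       Ext_vanish j K -> Ext_vanish j Q -> Ext_vanish j M,
     forall K M Q (i : {linear K -> M}) (p : {linear M -> Q}), ses i p ->
       Ext_vanish j M -> Ext_vanish j.+1 Q -> Ext_vanish j K &
     forall K M Q (i : {linear K -> M}) (p : {linear M -> Q}), ses i p ->
       Ext_vanish j K -> Ext_vanish j.+1 M -> Ext_vanish j.+1 Q].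
Proof.
elim: j => [|j [L1 L2 L3]].
  split=> K M Q i p s.
  - move=> EK EQ g x; have [ii ps ie] := s.
    have [gi giE] := lin_comp g i.
    have [|h hE] := lin_desc (u := g) ps.
      by move=> y /ie[k <-]; rewrite -giE EK.
    by rewrite -hE EQ.
  - by move=> EM EQ g x; have [h hE] := EQ _ _ _ _ s g; rewrite -hE EM.
  - move=> EK; apply: Ext1_vanish_quot s _ => g.
    by have [h hE] := lin0 M S; exists h => k; rewrite hE EK.
have {}L1 : forall K M Q (i : {linear K -> M}) (p : {linear M -> Q}), ses i p ->
       Ext_vanish j.+1 K -> Ext_vanish j.+1 Q -> Ext_vanish j.+1 M.
  move=> K M Q i p s; case: j L1 L2 L3 => [|j] L1 L2 L3; first exact: Ext1_vanish_ext s.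
  move=> EK EQ KM P a u Pp s'.
  have [KQ [b [v [c [d [s3 s4 _]]]]]] := rotate_from s s'.
  exact: L2 s4 (EQ _ _ _ _ Pp s3) EK.
have {}L2 : forall K M Q (i : {linear K -> M}) (p : {linear M -> Q}), ses i p ->
       Ext_vanish j.+1 M -> Ext_vanish j.+2 Q -> Ext_vanish j.+1 K.
  move=> K M Q i p s EM EQ; have [KM [P [a [u [Pp s']]]]] := presentation M.
  have [KQ [b [v [c [d [s3 s4 cE]]]]]] := rotate_from s s'.
  have EKQ := EQ _ _ _ _ Pp s3.
  case: j L1 L2 L3 EM EQ EKQ => [|j] L1 L2 L3 EM EQ EKQ.
    apply: Ext1_vanish_quot s4 _ EKQ => g.
    have [h hE] := EM _ _ _ _ s' g; have [hb hbE] := lin_comp h b.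
    by exists hb => k; rewrite hbE cE.
  exact: L3 s4 (EM _ _ _ _ Pp s') EKQ.
split=> // K M Q i p s EK EM N P i' q Pp s'.
have [KM [P' [a [u [Pp' s2]]]]] := presentation M.
have [KQ [b [v [c [d [s3 s4 cE]]]]]] := rotate_from s s2.
have EKQ := L1 _ _ _ _ _ s4 (EM _ _ _ _ Pp' s2) EK.
have [W [a' [b' [c' [d' [s5 s6 _ _ _]]]]]] := ses_pullback s' s3.
have EW := L1 _ _ _ _ _ s6 EKQ (Ext_vanish_proj _ Pp).
exact: L2 s5 EW (Ext_vanish_proj _ Pp').
Qed.

Section Les.
Variables (K M Q : lmodType R) (i : {linear K -> M}) (p : {linear M -> Q}).
Hypothesis s : ses i p.
Lemma Ext_vanish_mid j : Ext_vanish j K -> Ext_vanish j Q -> Ext_vanish j M.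
Proof. by have [L _ _] := Ext_vanish_les j; apply: L s. Qed.
Lemma Ext_vanish_sub j : Ext_vanish j M -> Ext_vanish j.+1 Q -> Ext_vanish j K.
Proof. by have [_ L _] := Ext_vanish_les j; apply: L s. Qed.
Lemma Ext_vanish_quot j : Ext_vanish j K -> Ext_vanish j.+1 M -> Ext_vanish j.+1 Q.
Proof. by have [_ _ L] := Ext_vanish_les j; apply: L s. Qed.
End Les.

Lemma Ext1_vanish_presentation K P M (i : {linear K -> P}) (p : {linear P -> M}) :
  projective P -> ses i p ->
  (forall g : {linear K -> S}, exists h : {linear P -> S}, forall k, h (i k) = g k) ->
  Ext_vanish 1 M.
Proof. by move=> Pp s ext; apply: Ext1_vanish_quot s ext (Ext_vanish_proj _ Pp). Qed.

(** The recursive notion agrees with the cohomology of Hom(C, S) for a projective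
    resolution C of M. The resolution is given by its components so that the
    induction can pass to the shifted one, which resolves the kernel of a. *)
Lemma Ext_vanish_complex j (C : nat -> lmodType R) (d : forall i, {linear C i.+1 -> C i})
    M (a : {linear C 0%N -> M}) :
  (forall i, projective (C i)) -> (forall y, exists x, a x = y) ->
  (forall x, a x = 0 <-> exists y, d 0%N y = x) ->
  (forall i x, d i x = 0 <-> exists y, d i.+1 y = x) ->
  Ext_vanish j.+1 M <->
  forall f : {linear C j.+1 -> S}, (forall x, f (d j.+1 x) = 0) ->
    exists g : {linear C j -> S}, forall x, f x = g (d j x).
Proof.
elim: j C d M a => [|j IH] C d M a Cp as_ a0 dd;
  have [K [i s]] := ker_ses as_; have [ii _ ie] := s;
  (have [|b bE] := lin_lift (u := d 0%N) ii;
    first by [move=> x; apply/ie/a0; exists x]);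
  have bs : (forall y, exists x, b x = y) by
    [move=> y; have /a0[x xE] : a (i y) = 0 by [apply: ses0 s];
     exists x; apply: ii; rewrite bE];
  have b0 x : b x = 0 <-> exists y, d 1%N y = x by
    [rewrite -dd -bE; split=> [->|]; [exact: raddf0|exact: inj0]].
  split=> [EM f f0|ext].
    have [|f' f'E] := lin_desc (u := f) bs.
      by move=> x /b0[y <-].
    have [h hE] := EM _ _ _ _ s f'; exists h => x.
    by rewrite -bE hE f'E.
  apply: Ext1_vanish_presentation (Cp 0%N) s _ => g.
  have [gb gbE] := lin_comp g b.
  have [|h hE] := ext gb.
    move=> x; rewrite gbE (_ : b _ = 0) ?raddf0 //.
    by apply/b0; exists x.
  by exists h => k; have [x <-] := bs k; rewrite bE -hE gbE.
rewrite -(IH (fun i => C i.+1) (fun i => d i.+1) K b (fun i => Cp i.+1) bs b0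
  (fun i => dd i.+1)).
split=> [EM|EK]; first exact: EM (Cp 0%N) s.
exact: (Ext_vanish_quot s EK (Ext_vanish_proj j.+1 (Cp 0%N))).
Qed.

Lemma Ext_vanish_resolution M (P : proj_resolution M) j :
  Ext_vanish j.+1 M <->
  forall f : {linear P j.+1 -> S}, cocycle f -> coboundary f.
Proof.
apply: (@Ext_vanish_complex j P (fun i => res_diff P i) M (res_aug P)).
- exact: res_projective.
- exact: res_aug_surj.
- exact: res_aug_exact.
- exact: res_exact.
Qed.

Lemma vanish_Ext_eq0 M j : Ext_vanish j.+1 M -> Ext_eq0 j.+1 M S.
Proof. by move=> /Ext_vanish_resolution E P; apply: E. Qed.

Lemma Ext_eq0_vanish M (P : proj_resolution M) j : Ext_eq0 j.+1 M S -> Ext_vanish j.+1 M.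
Proof. by move=> E; apply/(Ext_vanish_resolution P); apply: E. Qed.

Lemma pdim_le_vanish M n j : pdim_le M n -> (n < j)%N -> Ext_vanish j M.
Proof.
case: j => // j [P P0] nj; apply/(Ext_vanish_resolution P) => f _.
have [g gE] := lin0 (P j) S; exists g => x.
by rewrite (P0 _ nj x) gE raddf0.
Qed.

End Ext_vanish.

Lemma pdim_enough (R : pzRingType) :
  (forall M : lmodType R, exists n, pdim_le M n) -> enough_projectives R.
Proof.
move=> pd M; have [n [P _]] := pd M; exists (P 0%N), (res_aug P).
by split; [exact: res_projective|exact: res_aug_surj].
Qed.

(** * Noetherian modules *)

Section Noetherian.
Variable R : pzRingType.
Implicit Types K M Q : lmodType R.

(** A nonempty family of submodules of a Noetherian module has a maximal member
    (by dependent choice). *)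
Lemma noetherian_max M (F : submodClosed M -> Prop) :
  noetherian_module M -> (exists N, F N) ->
  exists N, F N /\ forall N', F N' -> {subset N <= N'} -> {subset N' <= N}.
Proof.
move=> nM [N0 F0]; apply: contrapT => none.
pose T := {N : submodClosed M | F N}.
have /choice[s sE] : forall N : T, exists N' : T,
    {subset sval N <= sval N'} /\ ~ {subset sval N' <= sval N}.
  move=> [N FN]; apply: contrapT => noN; apply: none; exists N; split=> // N' FN' NN'.
  by apply: contrapT => N'N; apply: noN; exists (exist _ N' FN').
pose c n := iter n s (exist _ N0 F0).
have [|n /(_ n.+1 (leqnSn n)) e] := nM (fun n => sval (c n)).
  by move=> n; case: (sE (c n)).
by case: (sE (c n)) => _; apply=> x; rewrite -e.
Qed.

Lemma noetherian_sub K M (i : {linear K -> M}) :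
  injective i -> noetherian_module M -> noetherian_module K.
Proof.
move=> ii nM N NS.
have /choice[N' N'E] : forall n, exists N' : submodClosed M,
    forall x, x \in N' <-> exists2 k, k \in N n & i k = x.
  by move=> n; have [N' N'E] := image_submod i (N n); exists N'.
have iN n k : (i k \in N' n) = (k \in N n).
  apply/idP/idP => [/N'E[l lN /ii <-] //|kN]; by apply/N'E; exists k.
have [|n nE] := nM N'.
  by move=> n x /N'E[k kN <-]; rewrite iN NS.
by exists n => m nm k; rewrite -!iN (nE _ nm).
Qed.

Lemma noetherian_quot M Q (p : {linear M -> Q}) :
  (forall y, exists x, p x = y) -> noetherian_module M -> noetherian_module Q.
Proof.
move=> ps nM N NS.
have /choice[N' N'E] : forall n, exists N' : submodClosed M,
    forall x, x \in N' <-> p x \in N n.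
  by move=> n; have [N' N'E] := preim_submod p (N n); exists N'.
have pN n x : (x \in N' n) = (p x \in N n) by apply/idP/idP => /N'E.
have [|n nE] := nM N'; first by move=> n x; rewrite !pN; apply: NS.
by exists n => m nm y; have [x <-] := ps y; rewrite -!pN (nE _ nm).
Qed.

Lemma subset_chain (T : Type) (N : nat -> {pred T}) :
  (forall n, {subset N n <= N n.+1}) -> forall n m, (n <= m)%N -> {subset N n <= N m}.
Proof.
move=> NS n; elim=> [|m IH]; first by rewrite leqn0 => /eqP ->.
by rewrite leq_eqVlt => /predU1P[->//|/IH H] x /H; apply: NS.
Qed.

Lemma submodB M (N : submodClosed M) x y : x \in N -> y \in N -> x - y \in N.
Proof. by move=> xN yN; rewrite -scaleN1r rpredD ?rpredZ. Qed.

(** Members of the chain are compared through their traces on K and their images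
    in Q. *)
Lemma noetherian_ses K M Q (i : {linear K -> M}) (p : {linear M -> Q}) : ses i p ->
  noetherian_module K -> noetherian_module Q -> noetherian_module M.
Proof.
move=> [ii ps ie] nK nQ N NS.
have /choice[N1 N1E] : forall n, exists N' : submodClosed K,
    forall x, x \in N' <-> i x \in N n.
  by move=> n; have [N' N'E] := preim_submod i (N n); exists N'.
have /choice[N2 N2E] : forall n, exists N' : submodClosed Q,
    forall x, x \in N' <-> exists2 k, k \in N n & p k = x.
  by move=> n; have [N' N'E] := image_submod p (N n); exists N'.
have [|n1 n1E] := nK N1; first by move=> n x /N1E /NS xN; apply/N1E.
have [|n2 n2E] := nQ N2.
  by move=> n x /N2E[k kN kx]; apply/N2E; exists k => //; apply: NS.
have NS' := subset_chain NS.
exists (maxn n1 n2) => m nm x; apply/idP/idP; last exact: NS'.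
move=> xm; have n1m : (n1 <= m)%N by apply: leq_trans nm; apply: leq_maxl.
have n2m : (n2 <= m)%N by apply: leq_trans nm; apply: leq_maxr.
have : p x \in N2 n2 by rewrite -(n2E _ n2m); apply/N2E; exists x.
move=> /N2E[y yN pxy].
have /ie[k kE] : p (x - y) = 0 by rewrite linearB pxy subrr.
have yM : y \in N (maxn n1 n2) by apply: NS' yN; apply: leq_maxr.
have ym : y \in N m by apply: NS' yM.
have : k \in N1 m by apply/N1E; rewrite kE submodB.
rewrite (n1E _ n1m) => /N1E; rewrite kE => xyN.
rewrite -(subrK y x) rpredD //; apply: NS' xyN; exact: leq_maxl.
Qed.

Lemma noetherian_prod M Q : noetherian_module M -> noetherian_module Q ->
  noetherian_module (M * Q)%type.
Proof.
move=> nM nQ; have [q qE] := lin_snd M Q.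
have [z zE] := lin0 M Q; have [o oE] := lin_id M; have [j jE] := lin_pair o z.
apply: (@noetherian_ses _ _ _ j q) => //; split.
- by move=> x y; rewrite !jE !oE => -[].
- by move=> y; exists (0, y); rewrite qE.
move=> [x y]; rewrite qE /=; split=> [->|[k]]; last by rewrite jE zE => -[].
by exists x; rewrite jE oE zE.
Qed.

End Noetherian.

(** * Restriction of modules to an idempotent subalgebra *)

Section CornerModules.
Variables (A : pzRingType) (f : A) (ff : idempotent_elt f).
Notation Gamma := (corner ff).
Implicit Types M N X C B H Z : rmodType A.
Let fc : A^c := f.

Lemma scale_conv M (a b : A) (x : M) :
  (a : A^c) *: ((b : A^c) *: x) = (b * a : A^c) *: x.
Proof. by rewrite scalerA. Qed.

Definition fpred M : {pred M} := fun x => fc *: x == x.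
Arguments fpred : clear implicits.

Fact fpred_closed M : zmod_closed (fpred M).
Proof.
split=> [|x y]; first by rewrite unfold_in scaler0.
by rewrite !unfold_in => /eqP xf /eqP yf; rewrite scalerBr xf yf.
Qed.
HB.instance Definition _ (M : rmodType A) :=
  GRing.isZmodClosed.Build M (fpred M) (fpred_closed M).

(** Mf = {x | xf = x} as a right module over fAf. The proof that f is idempotent
    is an argument because the scalar ring depends on it. *)
Definition fixed_part of idempotent_elt f :=
  fun M : rmodType A => {x : M | x \in fpred M}.
Notation fpart := (fixed_part ff).
HB.instance Definition _ (M : rmodType A) := SubType.on (fpart M).
HB.instance Definition _ (M : rmodType A) := Choice.on (fpart M).
HB.instance Definition _ (M : rmodType A) := [SubChoice_isSubZmodule of fpart M by <:].

Lemma corner_fr (g : Gamma) : val g * f = val g.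
Proof. by have /asboolP[a ->] := valP g; rewrite -!mulrA ff. Qed.

Lemma corner_valD (g h : Gamma) : val (g + h) = val g + val h.
Proof. by []. Qed.
Lemma corner_valM (g h : Gamma) : val (g * h) = val g * val h.
Proof. by []. Qed.

Fact fpart_scale_subproof M (g : Gamma) (x : M) : (val g : A^c) *: x \in fpred M.
Proof. by rewrite unfold_in /fc scale_conv corner_fr. Qed.

Definition fpart_scale M (g : Gamma^c) (x : fpart M) : fpart M :=
  Sub ((val (g : Gamma) : A^c) *: val x) (fpart_scale_subproof g (val x)).

Lemma fpartP M (x : fpart M) : fc *: val x = val x.
Proof. exact/eqP/(valP x). Qed.

Fact fpart_scaleA M (a b : Gamma^c) (x : fpart M) :
  fpart_scale a (fpart_scale b x) = fpart_scale (a * b) x.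
Proof. by apply: val_inj; rewrite /= scalerA. Qed.
Fact fpart_scale1 M : left_id 1 (@fpart_scale M).
Proof. by move=> x; apply: val_inj; rewrite /= -[RHS]fpartP. Qed.
Fact fpart_scaleDr M : right_distributive (@fpart_scale M) +%R.
Proof. by move=> g x y; apply: val_inj; rewrite /= scalerDr. Qed.
Fact fpart_scaleDl M (x : fpart M) : {morph (@fpart_scale M)^~ x : a b / a + b}.
Proof. by move=> a b; apply: val_inj; rewrite /= -scalerDl. Qed.
HB.instance Definition _ (M : rmodType A) := GRing.Zmodule_isLmodule.Build Gamma^c (fpart M)
  (@fpart_scaleA M) (@fpart_scale1 M) (@fpart_scaleDr M) (@fpart_scaleDl M).

Lemma fpart_scaleE M (g : Gamma^c) (x : fpart M) :
  val (g *: x) = (val (g : Gamma) : A^c) *: val x.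
Proof. by []. Qed.

Lemma fpart_valD M (x y : fpart M) : val (x + y) = val x + val y.
Proof. by []. Qed.

Lemma principal_valD e (x y : principal_mod e) : val (x + y) = (val x : A) + val y.
Proof. by []. Qed.

Lemma principal_valZ e (a : A) (x : principal_mod e) :
  val ((a : A^c) *: x) = (val x : A) * a.
Proof. by []. Qed.

Lemma fpart_of M (x : M) : fc *: x = x -> exists y : fpart M, val y = x.
Proof.
move=> /eqP xf; have xP : x \in fpred M by [].
by exists (Sub x xP); rewrite SubK.
Qed.

Lemma fpart_proj M (x : M) : exists y : fpart M, val y = fc *: x.
Proof. by apply: fpart_of; rewrite /fc scale_conv ff. Qed.

Lemma fpart_map M N (u : {linear M -> N}) :
  exists v : {linear fpart M -> fpart N}, forall x, val (v x) = u (val x).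
Proof.
have uf (x : fpart M) : u (val x) \in fpred N.
  by rewrite unfold_in -linearZ_LR fpartP.
pose v0 (x : fpart M) : fpart N := Sub (u (val x)) (uf x).
have L : linear v0.
  by move=> g x y; apply: val_inj; rewrite /= linearP.
by have [v vE] := linear_of L; exists v => x; rewrite vE.
Qed.

(** The right A-modules of the form Q (x) fA with Q a projective right
    fAf-module, by their universal property: Cf is projective and restriction to
    Cf is a bijection from Hom_A(C, X) to Hom_fAf(Cf, Xf) for all X. *)
Definition induced C : Prop :=
  [/\ projective (fpart C : lmodType Gamma^c),
      forall X (g : {linear fpart C -> fpart X}),
        exists h : {linear C -> X}, forall x, h (val x) = val (g x) &
      forall X (u : {linear C -> X}), (forall x : fpart C, u (val x) = 0) ->
        forall x, u x = 0].

Lemma induced_proj C : induced C -> projective C.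
Proof.
move=> [Cp Ce Cu] M N p u ps.
have [pf pfE] := fpart_map p; have [uf ufE] := fpart_map u.
have [|h hE] := Cp _ _ pf uf.
  move=> y; have [x xE] := ps (val y); have [z zE] := fpart_proj x.
  by exists z; apply: val_inj; rewrite pfE zE linearZ_LR xE fpartP.
have [h' h'E] := Ce _ h; have [ph phE] := lin_comp p h'.
have [d dE] := lin_sub ph u.
exists h' => x; rewrite -phE; apply: subr0_eq; rewrite -dE.
by apply: Cu => {}x; rewrite dE phE h'E -pfE hE ufE subrr.
Qed.

(** Mf = 0. *)
Definition killed M : Prop := forall x : M, fc *: x = 0.

Lemma induced_hom C M : induced C -> killed M -> forall (u : {linear C -> M}) x, u x = 0.
Proof.
by move=> [_ _ Cu] Mf u; apply: Cu => x; rewrite -fpartP linearZ_LR Mf.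
Qed.

Lemma induced_prod C C' : induced C -> induced C' -> induced (C * C')%type.
Proof.
move=> [Cp Ce Cu] [Cp' Ce' Cu'].
have [o1 o1E] := lin_id C; have [o2 o2E] := lin_id C'.
have [z1 z1E] := lin0 C C'; have [z2 z2E] := lin0 C' C.
have [i1 i1E] := lin_pair o1 z1; have [i2 i2E] := lin_pair z2 o2.
have [p1 p1E] := lin_fst C C'; have [p2 p2E] := lin_snd C C'.
have [j1 j1E] := fpart_map i1; have [j2 j2E] := fpart_map i2.
have [q1 q1E] := fpart_map p1; have [q2 q2E] := fpart_map p2.
have jq x : j1 (q1 x) + j2 (q2 x) = x.
  apply: val_inj; rewrite raddfD /= j1E j2E i1E i2E q1E q2E p1E p2E o1E o2E z1E z2E.
  by rewrite [RHS]surjective_pairing; congr pair; rewrite /= ?addr0 ?add0r.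
split.
- move=> M N p u ps.
  have [u1 u1E] := lin_comp u j1; have [u2 u2E] := lin_comp u j2.
  have [h1 h1E] := Cp _ _ p u1 ps; have [h2 h2E] := Cp' _ _ p u2 ps.
  have [k1 k1E] := lin_comp h1 q1; have [k2 k2E] := lin_comp h2 q2.
  have L : linear (fun x => k1 x + k2 x).
    by move=> a x y /=; rewrite !linearP scalerDr addrACA.
  have [h hE] := linear_of L; exists h => x.
  by rewrite hE linearD k1E k2E h1E h2E u1E u2E -linearD jq.
- move=> X g.
  have [g1 g1E] := lin_comp g j1; have [g2 g2E] := lin_comp g j2.
  have [h1 h1E] := Ce _ g1; have [h2 h2E] := Ce' _ g2.
  have [h hE] := lin_copair h1 h2; exists h => x.
  rewrite hE -p1E -q1E -p2E -q2E h1E h2E g1E g2E.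
  by rewrite -[in RHS](jq x) linearD.
- move=> X u u0 [x y].
  have [u1 u1E] := lin_comp u i1; have [u2 u2E] := lin_comp u i2.
  have -> : (x, y) = i1 x + i2 y.
    rewrite i1E i2E o1E o2E z1E z2E.
    by congr pair; rewrite /= ?addr0 ?add0r.
  rewrite linearD -u1E -u2E (Cu _ u1) ?(Cu' _ u2) ?addr0 // => {x y} x.
    by rewrite u2E -j2E u0.
  by rewrite u1E -j1E u0.
Qed.

Lemma principal_fl (x : principal_mod f) : f * (val x : A) = val x :> A.
Proof. by have /asboolP[a ->] := valP x; rewrite mulrA ff. Qed.

Lemma principal_gen : exists w : fpart (principal_mod f), val (val w) = f :> A.
Proof.
have fP : (f : rreg_mod A) \in principal f.
  by apply/asboolP; exists 1; rewrite mulr1.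
have [|w wE] := @fpart_of (principal_mod f : rmodType A) (Sub (f : rreg_mod A) fP).
  by apply: val_inj; exact: ff.
by exists w; rewrite wE SubK.
Qed.

(** fA is induced from the free module fAf. *)
Lemma induced_principal : induced (principal_mod f).
Proof.
have [w wE] := principal_gen.
have xw (x : principal_mod f) : x = (val x : A^c) *: val w.
  by apply: val_inj; rewrite principal_valZ wE principal_fl.
have cP (x : fpart (principal_mod f)) : exists g : Gamma, val g = val (val x) :> A.
  have gP : (val (val x) : A) \in corner_pred f.
    apply/asboolP; exists (val (val x)); rewrite principal_fl.
    by rewrite -[in LHS](fpartP x).
  by exists (Sub (val (val x) : A) gP); rewrite SubK.
have /choice[c cE] := cP.
have cL : forall (g : Gamma^c) x y, c (g *: x + y) = (c x) * (g : Gamma) + c y.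
  move=> g x y; apply: val_inj.
  rewrite cE corner_valD corner_valM !cE.
  by rewrite fpart_valD fpart_scaleE principal_valD principal_valZ.
have cw x : x = (c x : Gamma^c) *: w.
  by apply: val_inj; rewrite fpart_scaleE cE -xw.
split.
- move=> M N p u ps; have [m mE] := ps (u w).
  have L : linear (fun x => (c x : Gamma^c) *: m).
    move=> g x y; rewrite cL scalerDl; congr (_ + _).
    by rewrite scalerA.
  have [h hE] := linear_of L; exists h => x.
  by rewrite hE linearZ_LR mE -linearZ_LR -cw.
- move=> X g.
  have L : linear (fun x : principal_mod f => (val x : A^c) *: val (g w)).
    move=> a x y; rewrite raddfD /= scalerDl; congr (_ + _).
    by rewrite scalerA.
  have [h hE] := linear_of L; exists h => x.
  by rewrite hE -cE -fpart_scaleE -linearZ_LR -cw.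
- by move=> X u u0 x; rewrite (xw x) linearZ_LR u0 scaler0.
Qed.

Lemma noetherian_principal (e : A) : noetherian_ring A ->
  noetherian_module (principal_mod e : rmodType A).
Proof.
move=> [_ nA].
have L : linear (val : principal_mod e -> rreg_mod A) by move=> a x y; exact: linearP.
have [i iE] := linear_of L; apply: (@noetherian_sub _ _ _ i) nA => x y.
by rewrite !iE; apply: val_inj.
Qed.

(** Take C -> M whose image is maximal among the images of Noetherian induced
    modules. If x = xf, adding a copy of fA mapped onto xA cannot enlarge the
    image, so x is already in it. *)
Lemma induced_cover M : noetherian_ring A -> noetherian_module M ->
  exists C (p : {linear C -> M}), [/\ induced C, noetherian_module C &
    forall x : fpart M, exists c : fpart C, p (val c) = val x].
Proof.
move=> nA nM; have nf := @noetherian_principal f nA.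
pose F (N : submodClosed M) := exists C (p : {linear C -> M}),
  [/\ induced C, noetherian_module C & forall x, x \in N <-> exists c, p c = x].
have imF C (p : {linear C -> M}) : induced C -> noetherian_module C ->
    exists N : submodClosed M, F N /\ forall x, x \in N <-> exists c, p c = x.
  by move=> gC nC; have [N NE] := range_submod p; exists N; split=> //; exists C, p.
have [|N [[C [p [gC nC NE]]] Nmax]] := noetherian_max nM (F := F).
  have [z zE] := lin0 (principal_mod f : rmodType A) M.
  by have [N [FN _]] := imF _ z induced_principal nf; exists N.
exists C, p; split=> // x.
have L : linear (fun y : principal_mod f => (val y : A^c) *: val x).
  by move=> a y z; rewrite raddfD /= scalerDl; congr (_ + _); rewrite scalerA.
have [v vE] := linear_of L; have [q qE] := lin_copair p v.
have [N' [FN' N'E]] :=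
  imF _ q (induced_prod gC induced_principal) (noetherian_prod nC nf).
have [w wE] := principal_gen.
have NN' : {subset N <= N'}.
  by move=> y /NE[c <-]; apply/N'E; exists (c, 0); rewrite qE !raddf0 addr0.
have xN' : val x \in N'.
  by apply/N'E; exists (0, val w); rewrite qE vE /= wE raddf0 add0r fpartP.
have /NE[c cE] := Nmax _ FN' NN' _ xN'.
have [d dE] := fpart_proj c; exists d.
by rewrite dE linearZ_LR cE fpartP.
Qed.

(** * Vanishing in high degrees propagates to all degrees *)

(** In this section S is killed by f, and m > 0 is a degree such that, for
    Noetherian modules H with Hf = 0, Ext^j(H, S) vanishes for j > m while
    Ext^m(H, S) vanishes only for H = 0. *)

Section Collapse.
Variables (S : rmodType A) (m : nat).
Hypothesis m_gt0 : (0 < m)%N.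
Hypothesis nA : noetherian_ring A.
Hypothesis En : enough_projectives A^c.
Hypothesis killed_S : killed S.
Hypothesis killed_high : forall H : rmodType A, noetherian_module H -> killed H ->
  forall j, (m < j)%N -> Ext_vanish S j H.
Hypothesis killed_top : forall H : rmodType A, noetherian_module H -> killed H ->
  Ext_vanish S m H -> forall x : H, x = 0.

(** If Ext^j(M, S) vanishes in all degrees from m on, it vanishes in all degrees. *)
Definition collapses M :=
  (forall j, (m <= j)%N -> Ext_vanish S j M) -> forall j, Ext_vanish S j M.

Lemma Ext_vanish_zero (H : rmodType A) :
  (forall x : H, x = 0) -> forall j, Ext_vanish S j H.
Proof.
move=> H0 [|j]; first by move=> g x; rewrite (H0 x) raddf0.
apply: Ext_vanish_proj => M N g f' gs; have [z zE] := lin0 H M; exists z => x.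
by rewrite (H0 x) !raddf0.
Qed.

(** From the vanishing for M in degrees at least m follows the one for B, as
    Ext^(j+1)(H, S) = 0; so B has no Ext at all, Ext^m(H, S) = 0, and H = 0. *)
Lemma collapses_ext B M H (i : {linear B -> M}) (p : {linear M -> H}) :
  ses i p -> noetherian_module H -> killed H -> collapses B -> collapses M.
Proof.
move=> s nH kH cB EM; have EB : forall j, Ext_vanish S j B.
  apply: cB => j mj; apply: (Ext_vanish_sub En s); first exact: EM.
  exact: killed_high.
have H0 : forall x : H, x = 0.
  apply: killed_top => //; have := EB m.-1; have := EM m (leqnn m).
  by case: m m_gt0 => //= n _ E1 E2; apply: (Ext_vanish_quot En s).
by move=> j; apply: (Ext_vanish_mid En s) (EB j) (Ext_vanish_zero H0 j).
Qed.

Lemma induced_vanish C : induced C -> forall j, Ext_vanish S j C.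
Proof.
by move=> gC [|j]; [exact: induced_hom|apply/Ext_vanish_proj/induced_proj].
Qed.

Lemma collapses_cover Z C B (i : {linear Z -> C}) (p : {linear C -> B}) :
  ses i p -> (forall j, Ext_vanish S j C) -> collapses Z -> collapses B.
Proof.
move=> s EC cZ EB; have EZ : forall j, Ext_vanish S j Z.
  apply: cZ => j mj; apply: (Ext_vanish_sub En s); first exact: EC.
  by apply: EB; apply: leqW.
case=> [|j]; last exact: (Ext_vanish_quot En s).
move=> g x; have [_ ps _] := s; have [y <-] := ps x.
by have [h hE] := lin_comp g p; rewrite -hE; apply: (EC 0%N).
Qed.

(** The image B of p contains MfA, so M/B is killed by f, and the lemmas on
    extensions and on covers apply to 0 -> B -> M -> M/B -> 0 and C -> B. *)
Lemma collapses_ker C M Z (i : {linear Z -> C}) (p : {linear C -> M}) :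
  induced C -> injective i -> (forall x, p x = 0 <-> exists z, i z = x) ->
  (forall x : fpart M, exists c : fpart C, p (val c) = val x) ->
  noetherian_module M -> collapses Z -> collapses M.
Proof.
move=> gC ii ie pf nM cZ.
have [B [j [q [ji qs jq]]]] := image_exists p.
have [H [r s]] := coker_ses ji.
apply: (collapses_ext s).
- by have [_ rs _] := s; apply: noetherian_quot rs nM.
- have [_ rs re] := s; move=> x; have [y <-] := rs x; rewrite -linearZ_LR.
  have [y' y'E] := fpart_proj y; have [c cE] := pf y'.
  by apply/re; exists (q (val c)); rewrite jq cE y'E.
apply: (@collapses_cover _ _ _ i q _ (induced_vanish gC) cZ); split=> // x.
rewrite -ie -jq; split=> [->|]; [exact: raddf0|exact: inj0].
Qed.

(** Restriction to Mf is exact; p need only be surjective on the f-parts. *)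
Lemma fpart_ses C M Z (i : {linear Z -> C}) (p : {linear C -> M}) :
  injective i -> (forall x, p x = 0 <-> exists z, i z = x) ->
  (forall x : fpart M, exists c : fpart C, p (val c) = val x) ->
  exists (i' : {linear fpart Z -> fpart C}) (p' : {linear fpart C -> fpart M}),
    [/\ ses i' p', forall x, val (i' x) = i (val x) & forall x, val (p' x) = p (val x)].
Proof.
move=> ii ie pf; have [i' i'E] := fpart_map i; have [p' p'E] := fpart_map p.
exists i', p'; split=> //; split.
- by move=> x y xy; apply/val_inj/ii; rewrite -!i'E xy.
- by move=> y; have [c cE] := pf y; exists c; apply: val_inj; rewrite p'E.
move=> x; split=> [px|[z <-]]; last first.
  by apply: val_inj; rewrite p'E i'E; apply/ie; exists (val z).
have /ie[z zE] : p (val x) = 0 by rewrite -p'E px raddf0.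
have [|z' z'E] := @fpart_of Z z.
  by apply: ii; rewrite linearZ_LR zE fpartP.
by exists z'; apply: val_inj; rewrite i'E z'E zE.
Qed.

Lemma induced_presentation M : noetherian_module M ->
  exists C Z (i : {linear Z -> C}) (i' : {linear fpart Z -> fpart C})
      (p' : {linear fpart C -> fpart M}),
    [/\ induced C, noetherian_module Z, ses i' p', forall x, val (i' x) = i (val x) &
        collapses Z -> collapses M].
Proof.
move=> nM; have [C [p [gC nC pf]]] := induced_cover nA nM.
have [||Z [i [ii ie]]] := @submod_exists _ C (fun x => p x = 0).
- exact: raddf0.
- by move=> a x y px py; rewrite linearP px py scaler0 addr0.
have [i' [p' [s i'E p'E]]] := fpart_ses ii ie pf.
exists C, Z, i, i', p'; split=> //; first exact: noetherian_sub ii nC.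
exact: collapses_ker gC ii ie pf nM.
Qed.

(** Induction on the projective dimension d of Mf over fAf, expressed by the
    vanishing of Ext^(d+1)(Mf, Y) for all Y. *)
Lemma collapses_pd d M : noetherian_module M ->
  (forall Y : rmodType Gamma, Ext_vanish Y d.+1 (fpart M)) -> collapses M.
Proof.
elim: d M => [|d IH] M nM EM;
  have [C [Z [i [i' [p' [gC nZ s i'E cZ]]]]]] := induced_presentation nM;
  have [Cp Ce Cu] := gC; apply: cZ; last first.
  by apply: IH => // Y; exact: (EM Y _ _ _ _ Cp s).
(* Mf is projective: Zf is a direct summand of Cf, and the projection extends to
   an A-linear map r' from C to Z. Its image B is a direct summand of C with
   Bf = Zf, so that Z/B is killed by f. *)
have [one oneE] := lin_id (fpart Z).
have [r rE] := EM _ _ _ _ _ s one; have [r' r'E] := Ce _ r.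
have [ir irE] := lin_comp i r'; have [rir rirE] := lin_comp r' ir.
have [dd dE] := lin_sub rir r'.
have rr x : r' (i (r' x)) = r' x.
  apply: subr0_eq; rewrite -irE -rirE -dE; apply: Cu => {}x.
  rewrite dE rirE irE r'E -[i _]i'E r'E.
  by rewrite rE oneE subrr.
have [B [j [q [ji qs jq]]]] := image_exists r'.
have [H [t s']] := coker_ses ji; have [_ ts te] := s'.
apply: (collapses_ext s') => [||_].
- exact: noetherian_quot ts nZ.
- move=> x; have [y <-] := ts x; rewrite -linearZ_LR; apply/te.
  have [y' y'E] := fpart_proj y.
  by exists (q (i (val y'))); rewrite jq -i'E r'E rE oneE y'E.
have [ij ijE] := lin_comp i j.
have qij k : q (ij k) = k.
  by have [x <-] := qs k; apply: ji; rewrite ijE !jq rr.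
case=> [|n]; last first.
  by apply: Ext_vanish_proj; apply: proj_retract (induced_proj gC) qij.
move=> g x; rewrite -(qij x); have [gq <-] := lin_comp g q.
exact: induced_hom.
Qed.

End Collapse.
End CornerModules.

(** * The Jacobson radical and the simple module *)

Section Jacobson.
Variable A : pzRingType.
Hypothesis nA : noetherian_ring A.

Lemma jacobson_right_unit (x : A) : x \in @jacobson A -> exists y, (1 - x) * y = 1.
Proof.
move=> /asboolP xJ; apply: contrapT => nu.
pose F (I : submodClosed (rreg_mod A)) :=
  ((1 - x : A) : rreg_mod A) \in I /\ (1 : rreg_mod A) \notin I.
have [|I [[xI I1] Imax]] := noetherian_max (proj2 nA) (F := F).
  have [||I IE] := @submodule_of _ (rreg_mod A)
      (fun z => exists y : A, (1 - x) * y = z).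
  - by exists 0; rewrite mulr0.
  - by move=> a _ _ [y <-] [z <-]; exists (y * (a : A) + z); rewrite mulrDr mulrA.
  exists I; split; first by apply/IE; exists 1; rewrite mulr1.
  by apply/negP => /IE.
have maxI : maximal_submodule I.
  split; first by exists 1.
  move=> N IN; have [N1|N1] := boolP ((1 : rreg_mod A) \in N).
    right=> z; rewrite -[z](mul1r (z : A)); exact: (rpredZ (z : A^c) N1).
  left=> z; apply/idP/idP; last exact: IN.
  by apply: Imax => //; split=> //; apply: IN.
move/negP: I1; apply; have -> : (1 : rreg_mod A) = (1 - x) + x by rewrite subrK.
by rewrite rpredD // xJ.
Qed.

Lemma jacobson_unit (x : A) : x \in @jacobson A ->
  exists y, (1 - x) * y = 1 /\ y * (1 - x) = 1.
Proof.
move=> xJ; have [y xy] := jacobson_right_unit xJ; exists y; split=> //.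
have yE : y = 1 - - (x * y) by rewrite opprK -{1}xy mulrBl mul1r subrK.
have : (- (x * y) : A) \in @jacobson A.
  have -> : - (x * y) = x * (- y) by rewrite mulrN.
  exact: (@rpredZ _ _ (@jacobson A) (- y : A^c)).
move=> /jacobson_right_unit[z]; rewrite -yE => yz.
suff -> : 1 - x = z by [].
by rewrite -[LHS]mulr1 -[X in _ * X]yz mulrA xy mul1r.
Qed.

End Jacobson.

Section Ring.
Variables (k : fieldType) (A : algType k).
Hypotheses (A_basic : basic A) (A_semiperfect : semiperfect A).
Hypothesis nA : noetherian_ring A.
Variable e : A.
Hypothesis e_prim : primitive_idempotent e.
Let ee := primitive_idem e_prim.
Let J := @jacobson A.
Let q : A -> residue A := @residue_pi k A.

Lemma residueM x y : q (x * y) = q x * q y.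
Proof. exact: esym (residue_piM x y). Qed.
Lemma residueD x y : q (x + y) = q x + q y.
Proof. exact: residue_piD. Qed.
Lemma residueB x y : q (x - y) = q x - q y.
Proof. by apply: (addIr (q y)); rewrite -residueD !subrK. Qed.
Lemma residue_eq0 x : (x : A) \in J <-> q x = 0.
Proof.
rewrite /q -[0](subrr (q 0)) -residueB subrr.
by split=> [xJ|/residue_piP]; [apply/residue_piP|]; rewrite subr0.
Qed.
Lemma residue1 : q 1 = 1. Proof. by []. Qed.

(** The image of e in A / rad A is a central primitive idempotent: the first part
    is eA(1-e) in rad A, the second says that eA / e rad A is simple. *)
Lemma residue_idempotent :
  (forall a : A, e * a * (1 - e) \in J) /\
  (forall x : A, e * x = x -> x \notin J -> exists y : A, e - x * y \in J).
Proof.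
have [n [D [p [Ddiv pM pbij]]]] := A_basic.
have p1 i : p i 1 = 1 by case: (pM i).
have pmul i u v : p i (u * v) = p i u * p i v by case: (pM i) => _ ->.
have idem i u : u * u = u :> D i -> u = 0 \/ u = 1.
  move=> uu; have [->|u0] := eqVneq u 0; first by left.
  right; have [v [_ vu]] := Ddiv i u u0.
  by rewrite -[LHS]mul1r -vu -mulrA uu.
have pinj u v : (forall i, p i u = p i v) -> u = v.
  move=> uv; have [w [_ wu]] := pbij (fun i => p i v).
  by rewrite -(wu u) // -(wu v).
have J0 x : x \in J <-> forall i, p i (q x) = 0.
  rewrite residue_eq0; split=> [-> i|x0]; first by rewrite raddf0.
  by apply: pinj => i; rewrite x0 raddf0.
have pe i : p i (q e) = 0 \/ p i (q e) = 1.
  by apply: idem; rewrite -pmul -residueM ee.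
split=> [a|x ex xNJ].
  apply/J0 => i; rewrite !residueM residueB !pmul linearB residue1 p1.
  by case: (pe i) => ->; rewrite ?mul0r // subrr mulr0.
have [i xi] : exists i, p i (q x) != 0.
  apply: contrapT => none; move/negP: xNJ; apply; apply/J0 => i.
  by apply: contrapT => xi; apply: none; exists i; apply/eqP.
have ei : p i (q e) = 1.
  by case: (pe i) => // e0; move: xi; rewrite -ex residueM pmul e0 mul0r eqxx.
have uniq j : j != i -> p j (q e) = 0.
  move=> ji; case: (pe j) => // ej; exfalso.
  have [u [uE _]] := pbij (fun l => (l == i)%:R).
  have uu : idempotent_elt u.
    by apply: pinj => l; rewrite pmul !uE -natrM mulnb andbb.
  have [g [gg gu]] : exists g, g * g = g /\ q g = u := (proj2 A_semiperfect) u uu.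
  pose f := 1 - e.
  (* The lift g of u is conjugated by 1 - gf, a unit congruent to 1, so that the
     result g' satisfies g'f = 0; then eg' is an idempotent of eAe lifting u. *)
  have fJ : g * f \in J.
    apply/J0 => l; rewrite residueM pmul gu uE residueB linearB residue1 p1.
    by have [->|] := eqVneq l i; rewrite ?ei ?subrr ?mulr0 ?mul0r.
  have ff : f * f = f := idempotent_compl ee.
  have [v [fv vf]] := jacobson_unit nA fJ.
  pose g' := v * g * (1 - g * f).
  have gfv : g' * v = v * g by rewrite /g' -mulrA fv mulr1.
  have g'g' : g' * g' = g'.
    by rewrite {2}/g' !mulrA gfv -(mulrA v) gg.
  have g'f : g' * f = 0.
    by rewrite /g' -!mulrA mulrBl mul1r -(mulrA g) ff mulrBr mulrA gg subrr mulr0.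
  have g'e : g' * e = g'.
    have eE : e = 1 - f by rewrite /f subKr.
    by rewrite eE mulrBr mulr1 g'f subr0.
  have qgf : q (1 - g * f) = 1.
    by rewrite residueB (proj1 (residue_eq0 _) fJ) subr0.
  have qg' : q g' = u.
    have qv : q v = 1 by rewrite -[LHS]mulr1 -qgf -residueM vf.
    by rewrite /g' !residueM qgf qv mulr1 mul1r.
  pose e1 := e * g'.
  have e11 : e1 * e1 = e1 by rewrite /e1 mulrA -(mulrA e g') g'e -mulrA g'g'.
  have ee1 : e * e1 = e1 by rewrite /e1 mulrA ee.
  have e1e : e1 * e = e1 by rewrite /e1 -mulrA g'e.
  have pe1 l : p l (q e1) = p l (q e) * (l == i)%:R by rewrite residueM pmul qg' uE.
  have [_ _ irr] := e_prim.
  have [] := irr e1 (e - e1) e11.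
  - by rewrite /idempotent_elt mulrBl !mulrBr ee ee1 e1e e11 subrr subr0.
  - by rewrite mulrBr e1e e11 subrr.
  - by rewrite mulrBl ee1 e11 subrr.
  - by rewrite addrCA subrr addr0.
  - move=> e10; have := pe1 i; rewrite e10 eqxx ei mulr1.
    by rewrite (proj1 (residue_eq0 0)) ?rpred0 // raddf0 => /esym/eqP; rewrite oner_eq0.
  - move=> e20; have := congr1 (fun z => p j (q z)) e20.
    rewrite /= residueB linearB pe1 (negPf ji) mulr0 ej subr0.
    by rewrite (proj1 (residue_eq0 0)) ?rpred0 // raddf0 => /eqP; rewrite oner_eq0.
have inv l : exists y, p l (q x) * y = p l (q e).
  have [->|/uniq->] := eqVneq l i; last by exists 0; rewrite mulr0.
  by have [y [xy _]] := Ddiv i _ xi; exists y; rewrite xy ei.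
have [u [uE _]] := pbij (fun l => projT1 (cid (inv l))).
have [y yE] := residue_piK u; exists y; apply/J0 => l.
by rewrite residueB linearB residueM pmul /q -yE uE; case: cid => z /= ->; rewrite subrr.
Qed.

Let f := 1 - e.
Let ff : idempotent_elt f := idempotent_compl ee.
Let S : rmodType A := simple_top e.
Implicit Types M H K : rmodType A.
Let ec : A^c := e.

Lemma lin_orbit M (x : M) :
  exists u : {linear rreg_mod A -> M}, forall a : A, u a = (a : A^c) *: x.
Proof.
have L : linear (fun a : rreg_mod A => (a : A^c) *: x).
  by move=> a b c; rewrite scalerDl; congr (_ + _); rewrite scalerA.
by have [u uE] := linear_of L; exists u.
Qed.

Lemma killed_fix H (h : H) : killed f H -> ec *: h = h.
Proof.
move=> Hf; have := Hf h; rewrite /f.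
have -> : ((1 - e : A) : A^c) = (1 : A^c) - ec by [].
by rewrite scalerBl scale1r => /subr0_eq <-.
Qed.

(** The generator s of S is the class of e: its annihilator is {a | ea in rad A},
    and p : eA -> S has kernel e rad A. *)
Lemma simple_top_gen : exists s : S,
  [/\ forall t : S, exists a : A, t = (a : A^c) *: s,
      forall a : A, (a : A^c) *: s = 0 <-> e * a \in J &
      exists p : {linear principal_mod e -> S},
        [/\ forall t, exists x, p x = t,
            forall x, p x = (val x : A^c) *: s &
            forall x, p x = 0 <-> (val x : A) \in J]].
Proof.
have eP : (e : rreg_mod A) \in principal e.
  by apply/asboolP; exists 1; rewrite mulr1.
have [p pE] := quotmod_exists (principal_rad e).
pose w : principal_mod e := Sub (e : rreg_mod A) eP.
have wE : val w = e :> A by [].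
have xw (x : principal_mod e) : x = (val x : A^c) *: w.
  by apply: val_inj; rewrite principal_valZ wE principal_fl.
have ps t : exists x, p x = t.
  by have [x ->] := quotmod_piK t; exists x; rewrite pE.
have p0 x : p x = 0 <-> (val x : A) \in J.
  have pz : quotmod_pi (principal_rad e) 0 = 0 by rewrite -pE raddf0.
  have -> : p x = 0 <-> x \in principal_rad e.
    by rewrite pE -pz; split=> [/quotmod_piP|xN]; [|apply/quotmod_piP]; rewrite subr0.
  split=> [/asboolP[r rJ ->]|xJ]; first exact: jacobson_mull.
  by apply/asboolP; exists (val x : A) => //; rewrite principal_fl.
exists (p w); split=> [t|a|].
- by have [x <-] := ps t; exists (val x); rewrite -linearZ_LR -xw.
- rewrite -linearZ_LR p0.
  by rewrite principal_valZ wE.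
- by exists p; split=> // x; rewrite -linearZ_LR -xw.
Qed.

Lemma killed_simple_top : killed f S.
Proof.
have [s [sg s0 _]] := simple_top_gen; have [eaf _] := residue_idempotent.
move=> t; have [a ->] := sg t; rewrite scale_conv; apply/s0.
by rewrite mulrA; apply: eaf.
Qed.

(** K is e rad A. A map K -> S extends to eA because Ext^1(S, S) = 0, and maps
    from eA to S vanish on the radical. *)
Lemma hom_rad_eq0 K (i : {linear K -> principal_mod e}) :
  Ext_vanish S 1 S -> injective i ->
  (forall x, (val x : A) \in J <-> exists k, i k = x) ->
  Ext_vanish S 0 K.
Proof.
move=> E1 ii ie g y; have [s [sg s0 [p [ps pE p0]]]] := simple_top_gen.
have si : ses i p by split=> // x; rewrite p0.
have [h hE] := E1 _ _ _ _ si g; rewrite -hE.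
have xJ : (val (i y) : A) \in J by apply/ie; exists y.
have [w wE] := principal_gen ee.
have -> : i y = (val (i y) : A^c) *: val w.
  by apply: val_inj; rewrite principal_valZ wE principal_fl.
rewrite linearZ_LR; have [a ->] := sg (h (val w)).
rewrite scale_conv; apply/s0; apply: jacobson_mull; exact: jacobson_mull.
Qed.

(** In other words e rad A is contained in eAfA. Otherwise K = e rad A has a
    maximal submodule U containing the elements that annihilate all modules
    killed by f. Then K/U is simple and killed by f, hence isomorphic to S, which
    contradicts Hom(K, S) = 0. *)
Lemma killed_rad (E1 : Ext_vanish S 1 S) H (h : H) (r : A) :
  killed f H -> e * r \in J -> (r : A^c) *: h = 0.
Proof.
move=> Hf erJ; have [s [sg s0 [p [ps pE p0]]]] := simple_top_gen.
have [K [i sK]] := ker_ses ps; have [ii _ ie] := sK.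
have [_ inv] := residue_idempotent.
have ie' x : (val x : A) \in J <-> exists k, i k = x by rewrite -p0.
have HomK := hom_rad_eq0 E1 ii ie'.
pose w y : A := val (i y).
have wD x y : w (x + y) = w x + w y by rewrite /w linearD principal_valD.
have wZ (a : A) x : w ((a : A^c) *: x) = w x * a.
  by rewrite /w linearZ_LR principal_valZ.
pose T y := forall H (h : H), killed f H -> (w y : A^c) *: h = 0.
suff TK : forall y, T y.
  rewrite -[h](killed_fix h Hf) scale_conv.
  have eP : ((e * r : A) : rreg_mod A) \in principal e by apply/asboolP; exists r.
  have [y yE] : exists y, i y = Sub ((e * r : A) : rreg_mod A) eP by apply/ie'.
  by have := TK y H h Hf; rewrite /w yE SubK.
apply: contrapT => nT.
pose F (U : submodClosed K) := (forall y, T y -> y \in U) /\ exists y, y \notin U.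
have nK : noetherian_module K := noetherian_sub ii (noetherian_principal (e := e) nA).
have [|U [[TU [y0 y0U]] Umax]] := noetherian_max nK (F := F).
  have [||U UE] := @submodule_of _ K T.
  - by move=> H' h' Hf'; rewrite /w raddf0 scale0r.
  - move=> a x y Tx Ty H' h' Hf'; rewrite wD wZ.
    have -> : ((w x * (a : A) + w y : A) : A^c) = a * (w x : A^c) + (w y : A^c) by [].
    by rewrite scalerDl -scalerA Tx // Ty // scaler0 addr0.
  exists U; split; first by move=> y /UE.
  apply: contrapT => none; apply: nT => y; apply/UE.
  by apply: contrapT => /negP yU; apply: none; exists y.
have gen z : z \notin U -> forall y, exists a : A, y - (a : A^c) *: z \in U.
  move=> zU y.
  have [||U' UE] := @submodule_of _ K
      (fun y => exists a : A, y - (a : A^c) *: z \in U).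
  - by exists 0; rewrite scale0r subr0 rpred0.
  - move=> a x x' [b xb] [c xc]; exists (b * (a : A) + c).
    have -> : ((b * (a : A) + c : A) : A^c) = a * (b : A^c) + (c : A^c) by [].
    by rewrite scalerDl -scalerA opprD addrACA -scalerBr rpredD // rpredZ.
  have UU' : {subset U <= U'}.
    by move=> x xU; apply/UE; exists 0; rewrite scale0r subr0.
  have [/UE//|yU'] := boolP (y \in U').
  have FU' : F U' by split=> [x /TU /UU'|]; last by exists y.
  move/negP: zU; case; apply: (Umax _ FU' UU'); apply/UE; exists 1.
  have -> : ((1 : A) : A^c) = (1 : A^c) by [].
  by rewrite scale1r subrr rpred0.
have y0J (j : A) : j \in J -> (j : A^c) *: y0 \in U.
  move=> jJ; apply: contrapT => /negP jU.
  have [b bU] := gen _ jU y0.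
  have jbJ : j * b \in J by apply: jacobson_mulr.
  have [v [jv _]] := jacobson_unit nA jbJ.
  move/negP: y0U; apply.
  have := rpredZ (v : A^c) bU; rewrite scale_conv.
  have -> : y0 - ((j * b : A) : A^c) *: y0 = ((1 - j * b : A) : A^c) *: y0.
    have -> : ((1 - j * b : A) : A^c) = (1 : A^c) - ((j * b : A) : A^c) by [].
    by rewrite scalerBl scale1r.
  rewrite scale_conv jv.
  have -> : ((1 : A) : A^c) = (1 : A^c) by [].
  by rewrite scale1r.
have Kf y : (f : A^c) *: y \in U.
  apply: TU => H' h' Hf'; rewrite wZ -scale_conv Hf' //.
have y0e : (ec *: y0 \in U) -> False.
  move=> eU; move/negP: y0U; apply.
  have -> : y0 = ec *: y0 + (f : A^c) *: y0.
    rewrite -scalerDl; have -> : ec + (f : A^c) = (1 : A^c).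
      by rewrite /ec /f; exact: (subrKC e 1).
    by rewrite scale1r.
  by rewrite rpredD.
have y0a (a : A) : (a : A^c) *: y0 \in U -> e * a \in J.
  move=> aU; apply: contrapT => /negP eaNJ.
  have [|b bJ] := inv (e * a) _ eaNJ; first by rewrite mulrA ee.
  apply: y0e.
  have fa : ((f * a * b : A) : A^c) *: y0 \in U.
    by rewrite -!scale_conv; do 2!apply: rpredZ; apply: Kf.
  have ab : ((a * b : A) : A^c) *: y0 \in U by rewrite -scale_conv rpredZ.
  have eab : ((e * a * b : A) : A^c) *: y0 \in U.
    have -> : ((e * a * b : A) : A^c) = ((a * b : A) : A^c) - ((f * a * b : A) : A^c).
      have E : e * a * b = a * b - f * a * b by rewrite /f !mulrBl !mul1r subKr.
      by rewrite E.
    by rewrite scalerBl submodB.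
  have -> : ec = ((e - e * a * b : A) : A^c) + ((e * a * b : A) : A^c).
    by apply: esym; exact: (subrK (e * a * b) e).
  by rewrite scalerDl rpredD // y0J.
(* A y0 |-> A s is a well-defined map on K, because U goes to 0. *)
have [iU iUE] := submodule_incl U; have [o oE] := lin_orbit y0.
have [pr prE] := lin_copair iU o.
have [os osE] := lin_orbit s; have [zU zUE] := lin0 (submodule U : rmodType A) S.
have [ps' psE] := lin_copair zU os.
have prs y : exists x, pr x = y.
  have [a aU] := gen _ y0U y.
  exists ((Sub (y - (a : A^c) *: y0) aU : submodule U), (a : rreg_mod A)).
  by rewrite prE iUE SubK oE subrK.
have [|b bE] := lin_desc (u := ps') prs.
  move=> [u a]; rewrite prE psE zUE add0r iUE oE osE /= => ua.
  apply/s0/y0a.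
  have -> : (a : A^c) *: y0 = - val u by apply: (addrI (val u)); rewrite ua subrr.
  by rewrite -scaleN1r rpredZ // (valP u).
have := bE (0, 1); rewrite HomK psE zUE osE add0r /= => /esym/s0.
rewrite mulr1 => eJ.
by apply: y0e; apply: y0J.
Qed.

(** The copy of S is generated by h: the annihilator of h contains that of the
    class of e by the inclusion of e rad A in eAfA, and S is simple. *)
Lemma simple_top_embeds (E1 : Ext_vanish S 1 S) H (h : H) : killed f H -> h != 0 ->
  exists j : {linear S -> H}, injective j /\ exists s, j s = h.
Proof.
move=> Hf h0; have [s [sg s0 _]] := simple_top_gen.
have [_ inv] := residue_idempotent.
have [os osE] := lin_orbit s; have [oh ohE] := lin_orbit h.
have oss t : exists a, os a = t by have [a ->] := sg t; exists a; rewrite osE.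
have [|j jE] := lin_desc (u := oh) oss.
  by move=> a; rewrite osE ohE => /s0; apply: killed_rad.
have js (a : A) : j ((a : A^c) *: s) = (a : A^c) *: h by rewrite -osE jE ohE.
exists j; split; last first.
  exists s; have := js 1; have -> : ((1 : A) : A^c) = (1 : A^c) by [].
  by rewrite !scale1r.
apply: lin_inj => t; have [a ->] := sg t; rewrite js => ah; apply/s0.
apply: contrapT => /negP eaNJ.
have [|b bJ] := inv (e * a) _ eaNJ; first by rewrite mulrA ee.
have bJ' : e * (e - e * a * b) \in J.
  by rewrite mulrBr !mulrA ee.
have := killed_rad E1 h Hf bJ'.
have -> : ((e - e * a * b : A) : A^c) = ec - ((e * a * b : A) : A^c) by [].
rewrite scalerBl killed_fix // -!scale_conv (killed_fix h Hf) ah scaler0 subr0.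
by move/eqP; rewrite (negPf h0).
Qed.

Lemma killed_quot H M (p : {linear H -> M}) :
  (forall y, exists x, p x = y) -> killed f H -> killed f M.
Proof. by move=> ps Hf y; have [x <-] := ps y; rewrite -linearZ_LR Hf raddf0. Qed.

(** A Noetherian module killed by f is an iterated extension of copies of S: a
    submodule that is maximal for the vanishing is everything, since the quotient
    would contain a copy of S. *)
Lemma killed_vanish (E1 : Ext_vanish S 1 S) (En : enough_projectives A^c) j :
  Ext_vanish S j S ->
  forall H, noetherian_module H -> killed f H -> Ext_vanish S j H.
Proof.
move=> ES H nH Hf.
pose F (U : submodClosed H) := exists K (i : {linear K -> H}),
  [/\ injective i, Ext_vanish S j K & forall x, x \in U <-> exists y, i y = x].
have [|U [[K [i [ii EK UE]]] Umax]] := noetherian_max nH (F := F).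
  have [||U UE] := @submodule_of _ H (fun x => x = 0) => //.
  - by move=> a x y -> ->; rewrite scaler0 addr0.
  have [iU iUE] := submodule_incl U.
  exists U, (submodule U : rmodType A), iU; split.
  - by move=> x y; rewrite !iUE => /val_inj.
  - by apply: Ext_vanish_zero => x; apply: val_inj; apply/UE; apply: valP.
  - move=> x; split=> [xU|[y <-]]; last by rewrite iUE (valP y).
    by exists (Sub x xU); rewrite iUE SubK.
have [M [p s]] := coker_ses ii; have [_ ps pe] := s.
apply: (Ext_vanish_mid En s) => //; apply: Ext_vanish_zero => y; apply: contrapT => /eqP y0.
have [g [gi [t gt]]] := simple_top_embeds E1 (killed_quot ps Hf) y0.
have [||L [l [li lE]]] := @submod_exists _ H (fun x => exists t, p x = g t).
- by exists 0; rewrite !raddf0.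
- by move=> a x z [b xb] [c zc]; exists (a *: b + c); rewrite !linearP xb zc.
have [pl plE] := lin_comp p l.
have [|d dE] := lin_lift (u := pl) gi.
  have lL z : exists t, p (l z) = g t by apply/lE; exists z.
  by move=> z; have [t' tE] := lL z; exists t'; rewrite plE tE.
have [|c cE] := lin_lift (u := i) li.
  by move=> z; apply/lE; exists 0; rewrite raddf0 (ses0 _ s).
have sL : ses c d.
  split.
  - apply: lin_inj => z cz; apply: (inj0 ii); by rewrite -cE cz raddf0.
  - move=> t'; have [x xE] := ps (g t').
    have /lE[z zE] : exists t, p x = g t by exists t'.
    by exists z; apply: gi; rewrite dE plE zE xE.
  move=> z; split=> [dz|[z' <-]]; last first.
    by apply: (inj0 gi); rewrite dE plE cE (ses0 _ s).
  have /pe[k' kE] : p (l z) = 0 by rewrite -plE -dE dz raddf0.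
  by exists k'; apply: li; rewrite cE.
have EL : Ext_vanish S j L := Ext_vanish_mid En sL EK ES.
have [U' UE'] := range_submod l.
have FU' : F U' by exists L, l.
have UU' : {subset U <= U'}.
  by move=> x /UE[z <-]; apply/UE'; exists (c z); rewrite cE.
have [x xE] := ps y; have xU' : x \in U' by apply/UE'/lE; exists t; rewrite xE gt.
have /UE/pe px := Umax _ FU' UU' _ xU'.
by move: y0; rewrite -xE px eqxx.
Qed.

Lemma self_orthogonal (Ext1 : Ext_eq0 1 S S) (Agl : finite_gldim A)
    (Ggl : finite_gldim (corner ff)) :
  forall i, (0 < i)%N -> Ext_eq0 i S S.
Proof.
have [dA glA] := Agl; have [dG glG] := Ggl.
have En : enough_projectives A^c by apply: pdim_enough => M; exists dA; apply: glA.
have EnG : enough_projectives (corner ff)^c.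
  by apply: pdim_enough => M; exists dG; apply: glG.
have [P _] := glA S; have E1 : Ext_vanish S 1 S := Ext_eq0_vanish En P Ext1.
suff E j : (0 < j)%N -> Ext_vanish S j S.
  by case=> // i _; apply: (vanish_Ext_eq0 En); apply: E.
(* m is the largest degree with Ext^m(S, S) nonzero *)
move=> j0; apply: contrapT => nE.
have bound m : ~ Ext_vanish S m S -> (m <= dA)%N.
  move=> nm; rewrite leqNgt; apply/negP => dm; apply: nm.
  exact: (pdim_le_vanish S En (glA S) dm).
have exm : exists m, `[< ~ Ext_vanish S m S >] by exists j; apply/asboolP.
have ubm m : `[< ~ Ext_vanish S m S >] -> (m <= dA)%N by move/asboolP/bound.
have [m /asboolP nm mmax] := ex_maxnP exm ubm.
have m0 : (0 < m)%N by apply: leq_trans j0 (mmax _ _); apply/asboolP.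
have high H : noetherian_module H -> killed f H ->
    forall i, (m < i)%N -> Ext_vanish S i H.
  move=> nH Hf i mi; apply: killed_vanish => //; apply: contrapT => nEi.
  by move: mi; rewrite ltnNge mmax //; apply/asboolP.
have top H : noetherian_module H -> killed f H -> Ext_vanish S m H -> forall x : H, x = 0.
  move=> nH Hf EH x; apply: contrapT => /eqP x0; apply: nm.
  have [g [gi _]] := simple_top_embeds E1 Hf x0.
  have [M [p s]] := coker_ses gi; have [_ ps _] := s.
  apply: (Ext_vanish_sub En s EH); apply: high => //; last exact: killed_quot Hf.
  exact: noetherian_quot ps nH.
have neA := noetherian_principal (e := e) nA.
have col : collapses S m (principal_mod e : rmodType A).
  apply: (collapses_pd (ff := ff) m0 nA En killed_simple_top high top (d := dG)) => // Y.
  exact: (pdim_le_vanish Y EnG (glG _)).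
have eproj : projective (principal_mod e : rmodType A).
  exact: induced_proj (induced_principal ee).
(* eA is projective and m > 0, so the vanishing in degrees at least m is clear *)
have E0 : Ext_vanish S 0 (principal_mod e : rmodType A).
  apply: col => i mi; have i0 : (0 < i)%N := leq_trans m0 mi.
  by rewrite -(prednK i0); apply: Ext_vanish_proj.
have [s [sg s0 [p [ps pE p0]]]] := simple_top_gen.
have sz : s = 0 by have [x <-] := ps s; apply: E0.
have eJ : e \in J by rewrite -[e]mulr1; apply/s0; rewrite sz scaler0.
have [v [ev _]] := jacobson_unit nA eJ.
have [_ /eqP eN0 _] := e_prim; apply: eN0.
by rewrite -[LHS]mulr1 -[X in _ * X]ev mulrA mulrBr mulr1 ee subrr mul0r.
Qed.

End Ring.

Theorem theorem6p5 (k : closedFieldType) (A : algType k)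
  (A_basic : basic A) (A_semiperfect : semiperfect A)
  (A_noetherian : noetherian_ring A)
  (A_residue_fd : finite_dimensional (residue A))
  (e : A) (e_prim : primitive_idempotent e)
  (Gamma := corner (idempotent_compl (primitive_idem e_prim)))
  (S_e := simple_top e)
  (Ext1_eq0 : Ext_eq0 1 S_e S_e)
  (A_gldim : finite_gldim A) (Gamma_gldim : finite_gldim Gamma) :
  forall i : nat, (0 < i)%N -> Ext_eq0 i S_e S_e.
Proof.
exact: (self_orthogonal A_basic A_semiperfect A_noetherian Ext1_eq0 A_gldim
  Gamma_gldim).
Qed.
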